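(* Let $N\ge2$. For $\gamma>0$ and $\epsilon\ne0$ sufficiently small and $\omega$ in a neighborhood of $1$, let $(p^*,q^* )$ be the damped and driven breather with corresponding driving strength $\beta=\beta(\epsilon,\gamma,\omega)$. Then the linearization (the $2N\times2N$ Jacobian matrix of the vector field, with $\beta$ fixed) of the damped and driven system $$\dot p_j=\epsilon(\Delta q)_j+\omega q_j-(p_j^2+q_j^2)q_j+\beta\delta_{j,1}p_1-\gamma\delta_{j,N}p_N,$$ $$\dot q_j=-\epsilon(\Delta p)_j-\omega p_j+(p_j^2+q_j^2)p_j+\beta\delta_{j,1}q_1-\gamma\delta_{j,N}q_N,\qquad j=1,\dots,N,$$ at the fixed point $(p^*,q^* )$ has one zero eigenvalue (corresponding to the rotation symmetry of the system), one very small positive eigenvalue (tending to $0$ as $(\epsilon,\gamma)\to(0,0)$), and all the remaining $2N-2$ eigenvalues have strictly negative real part.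
   Context: Here $p=(p_1,\dots,p_N)$ and $q=(q_1,\dots,q_N)$ are real vectors, $\delta_{j,k}$ is the Kronecker delta, and $(\Delta p)_1=p_2-p_1$, $(\Delta p)_j=p_{j+1}+p_{j-1}-2p_j$ for $2\le j\le N-1$, $(\Delta p)_N=p_{N-1}-p_N$. The system is invariant under the rotations $p_j+iq_j\mapsto e^{i\theta}(p_j+iq_j)$ (same $\theta$ for all $j$). The damped and driven breather: for $\epsilon,\gamma$ sufficiently small and $\omega$ in a neighborhood of $1$ there is a unique $\beta=\beta(\epsilon,\gamma,\omega)$ for which the system has a stationary solution near $p=(1,0,\dots,0)$, $q=0$; this stationary solution, normalized by rotation so that $q_1^*=0$ and $p_1^*>0$, is denoted $(p^*,q^* )$, is unique and depends smoothly on $(\epsilon,\gamma,\omega)$. *)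

(* Defs.v *)
(* MathComp-Analysis, over an arbitrary [R : realType]; complex numbers are
   [R[i]] from mathcomp-real-closed. *)
From HB Require Import structures.
From mathcomp Require Import all_boot all_order all_algebra.
From mathcomp Require Import complex.
From mathcomp Require Import all_classical all_reals all_analysis.

Set Implicit Arguments.
Unset Strict Implicit.
Unset Printing Implicit Defensive.

Import Order.TTheory GRing.Theory Num.Theory.
Import numFieldNormedType.Exports.

Local Open Scope classical_set_scope.
Local Open Scope ring_scope.

(* Sites are numbered from 0, so the sites 1 and N of the chain have the
   indices 0 and N.-1.  [site p k] reads the entry k of p (0 if N <= k). *)
Definition site (R : realType) (N : nat) (p : 'rV[R]_N) (k : nat) : R :=
  if insub k is Some j then p 0 j else 0.

Definition laplacian (R : realType) (N : nat) (p : 'rV[R]_N) : 'rV[R]_N :=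
  \row_(j < N)
    if (j : nat) == 0%N then site p 1%N - site p 0%N
    else if j.+1 == N then site p N.-2 - site p N.-1
    else site p j.+1 + site p j.-1 - 2%:R * site p j.

(* A state is the concatenation [row_mx p q]; parameters are triples
   (epsilon, gamma, omega). *)
Definition vector_field (R : realType) (N : nat) (x : R * R * R) (beta : R)
    (v : 'rV[R]_(N + N)) : 'rV[R]_(N + N) :=
  let: (eps, gamma, omega) := x in
  let p := lsubmx v in
  let q := rsubmx v in
  row_mx
    (\row_(j < N)
      (eps * laplacian q 0 j + omega * q 0 j
       - (p 0 j ^+ 2 + q 0 j ^+ 2) * q 0 j
       + beta * ((j : nat) == 0%N)%:R * p 0 j
       - gamma * (j.+1 == N)%:R * p 0 j))
    (\row_(j < N)
      (- eps * laplacian p 0 j - omega * p 0 j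
       + (p 0 j ^+ 2 + q 0 j ^+ 2) * p 0 j
       + beta * ((j : nat) == 0%N)%:R * q 0 j
       - gamma * (j.+1 == N)%:R * q 0 j)).

Definition stationary (R : realType) (N : nat) (x : R * R * R) (beta : R)
    (p q : 'rV[R]_N) : Prop :=
  vector_field x beta (row_mx p q) = 0.

(* [jacobian] acts on row vectors from the right; its transpose is the usual
   Jacobian matrix, whose entry (i, j) is the derivative of the i-th component
   with respect to the j-th variable. *)
Definition linearization (R : realType) (N : nat) (x : R * R * R) (beta : R)
    (p q : 'rV[R]_N) : 'M[R]_(N + N) :=
  (jacobian (vector_field x beta) (row_mx p q))^T.

(* The sequence s lists the complex eigenvalues of A, repeated according to
   their algebraic multiplicity. *)
Definition eigenvalues (R : realType) (m : nat) (A : 'M[R]_m) (s : seq R[i])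
    : Prop :=
  char_poly (map_mx (real_complex R) A) = \prod_(z <- s) ('X - z%:P).

(* The derivative at theta = 0 of the rotation p_j + i q_j |->
   e^{i theta} (p_j + i q_j). *)
Definition rotation_generator (R : realType) (N : nat) (p q : 'rV[R]_N)
    : 'rV[R]_(N + N) :=
  row_mx (- q) p.

(* C^k on the open set U, through iterated directional derivatives; for maps
   between finite-dimensional spaces this is the usual notion. *)
Fixpoint Ck_on (R : realType) (V W : normedModType R) (U : set V) (k : nat)
    (f : V -> W) : Prop :=
  (forall x, U x -> {for x, continuous f}) /\
  if k is k'.+1 then
    forall v : V, (forall x, U x -> derivable f x v) /\
                  Ck_on U k' (fun x => 'D_v f x)
  else True.

Definition smooth_on (R : realType) (V W : normedModType R) (U : set V)
    (f : V -> W) : Prop :=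
  forall k : nat, Ck_on U k f.

(* Distance less than rho to p = (1,0,...,0), q = 0, in the maximum norm. *)
Definition near_one_site (R : realType) (N : nat) (rho : R) (p q : 'rV[R]_N)
    : Prop :=
  `|p - \row_(j < N) ((j : nat) == 0%N)%:R| < rho /\ `|q| < rho.

Definition normalized (R : realType) (N : nat) (p q : 'rV[R]_N) : Prop :=
  site q 0%N = 0 /\ 0 < site p 0%N.

(* beta is the only driving strength that admits a stationary solution close to
   the one-site state, and (p, q) is the only normalized such solution. *)
Definition is_breather (R : realType) (N : nat) (rho : R) (x : R * R * R)
    (beta : R) (p q : 'rV[R]_N) : Prop :=
  [/\ stationary x beta p q, near_one_site rho p q, normalized p q &
      forall (beta' : R) (p' q' : 'rV[R]_N),
        stationary x beta' p' q' -> near_one_site rho p' q' ->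
        beta' = beta /\ (normalized p' q' -> p' = p /\ q' = q)].

(* The damped and driven breather, as a function of the parameters near
   (epsilon, gamma, omega) = (0, 0, 1). *)
Definition breather_family (R : realType) (N : nat) (beta : R * R * R -> R)
    (p q : R * R * R -> 'rV[R]_N) : Prop :=
  exists (U : set (R * R * R)) (rho : R),
    [/\ open U, U (0, 0, 1), 0 < rho,
        forall x, U x -> is_breather rho x (beta x) (p x) (q x) &
        smooth_on U p /\ smooth_on U q].

(* Main.v *)
Require Import Defs.
From HB Require Import structures.
From mathcomp Require Import all_boot all_order all_algebra.
From mathcomp Require Import complex ring lra zify.
From mathcomp Require Import all_classical all_reals all_analysis.

Set Implicit Arguments.
Unset Strict Implicit.
Unset Printing Implicit Defensive.

Import Order.TTheory GRing.Theory Num.Theory.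
Import numFieldNormedType.Exports.

Local Open Scope ring_scope.

(** Write [u_k = p_k + i q_k], number the sites [0..n], and let [J] be the
    linearization.  At the base point [eps = gamma = 0], [omega = 1] the breather
    is [u = (1, 0, ..., 0)] and the eigenvalues are 0 (twice, from the driven
    site) and [i], [-i] ([n] times each, from the other sites).  Uniqueness of the
    breather identifies the state there; smoothness of the family allows the
    stationarity equations to be differentiated in [omega] and makes the state
    and this derivative continuous.  The two groups of eigenvalues are treated
    separately.

    The double eigenvalue.  Rotation invariance gives [g J = 0] for the rotation
    generator [g], and differentiating the stationarity equations in [omega]
    gives [h J = g - b e], where [h] is the derivative of the state,
    [b = d beta / d omega] and [e] is the state cut down to the driven site.
    With Cramer's rule these two relations factor the characteristic polynomial
    as [X (X D_h + b D_e) / p_0] ([char_poly_split]); near the base point [D_h] is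
    close to 1 and [D_e] close to 2 at 0, so besides 0 there is exactly one root
    near 0, it is real, and it is about [- 2 b] ([small_root]).  Hence it is
    positive and of order [gamma] as soon as [b] is negative and of order
    [gamma].  The power balance [beta |u_0|^2 = gamma |u_n|^2] reduces the sign
    of [b] to the logarithmic derivative of [u_n / u_0] in [omega].  Since
    [u_(k+1)] is about [- (eps / omega) u_k], this quotient behaves like a
    constant times [omega^(-n)], and [b < 0] ([driving_slope_lt0]).

    The oscillating eigenvalues.  For [gamma] small there is no uniform gap
    between their real parts and 0, so perturbation theory does not suffice.
    Instead, a complex eigenvector is written as a pair [(x, y)], the components
    along [u] and along its conjugate, and the charge
    [sum_k (|x_k|^2 - |y_k|^2)], which the conservative part preserves, is used:
    [Re z] times the charge equals
    [beta (|x_0|^2 - |y_0|^2) - gamma (|x_n|^2 - |y_n|^2)] ([charge_balance]).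
    For [z] near [-i] the component [y] is negligible, and solving the recurrence
    from the damped end shows that [|x_n|] is at least of order [|eps|^(n-1)]
    times the largest entry ([mode_profile]).  On the other hand
    [beta <= gamma (4 |eps|)^(2n)], so the gain at the driven site is smaller than
    the loss at the damped site by a factor [eps^2], uniformly in the ratio of
    [eps] and [gamma]; thus [Re z < 0] ([resonant_Re_lt0]).  Complex conjugation
    covers [z] near [i]. *)

(** * The modulus of a complex number *)

Section Modulus.
Variable R : rcfType.
Implicit Types (z w : R[i]) (a : R).

Definition modulus z : R := ComplexField.Normc.normc z.

Lemma modulusM z w : modulus (z * w) = modulus z * modulus w.
Proof. exact: ComplexField.Normc.normcM. Qed.

Lemma modulusV z : modulus z^-1 = (modulus z)^-1.
Proof. exact: ComplexField.Normc.normcV. Qed.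

Lemma modulus0 : modulus (0 : R[i]) = 0.
Proof. exact: ComplexField.Normc.normc0. Qed.

Lemma modulus_eq0 z : modulus z = 0 -> z = 0.
Proof. exact: ComplexField.Normc.eq0_normc. Qed.

Lemma modulus_ge0 z : 0 <= modulus z.
Proof. by case: z => a b; rewrite /modulus /= sqrtr_ge0. Qed.

Lemma modulus_gt0 z : z != 0 -> 0 < modulus z.
Proof.
move=> z0; rewrite lt_def modulus_ge0 andbT; apply: contraNneq z0.
by move/modulus_eq0 ->.
Qed.

Lemma modulusN z : modulus (- z) = modulus z.
Proof. exact: normcN. Qed.

Lemma modulusD z w : modulus (z + w) <= modulus z + modulus w.
Proof. exact: le_normcD. Qed.

Lemma modulusB z w : modulus (z - w) <= modulus z + modulus w.
Proof. by rewrite -(modulusN w) modulusD. Qed.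

Lemma modulus_real a : modulus a%:C%C = `|a|.
Proof. by rewrite /modulus /= expr0n addr0 sqrtr_sqr. Qed.

Lemma modulus_nat m : modulus (m%:R : R[i]) = m%:R.
Proof.
have -> : (m%:R : R[i]) = (m%:R : R)%:C%C by rewrite rmorph_nat.
by rewrite modulus_real normr_nat.
Qed.

Lemma modulusi : modulus ('i%C : R[i]) = 1.
Proof. by rewrite /modulus /= expr0n add0r expr1n sqrtr1. Qed.

Lemma modulusJ z : modulus (conjc z) = modulus z.
Proof. by case: z => a b; rewrite /modulus /= sqrrN. Qed.

Lemma mul_conjc z : z * conjc z = (modulus z ^+ 2)%:C%C.
Proof.
case: z => a b; rewrite /modulus /= sqr_sqrtr ?addr_ge0 ?sqr_ge0 //.
by apply/eqP; rewrite eq_complex /=; apply/andP; split; apply/eqP; ring.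
Qed.

Lemma Re_le_modulus z : `|complex.Re z| <= modulus z.
Proof.
case: z => a b; rewrite /modulus /= -sqrtr_sqr ler_wsqrtr //.
by rewrite lerDl sqr_ge0.
Qed.

Lemma modulus_le_ReIm z : modulus z <= `|complex.Re z| + `|complex.Im z|.
Proof.
rewrite {1}[z]complexE; apply: le_trans (modulusD _ _) _.
by rewrite modulusM modulusi mul1r !modulus_real.
Qed.

Lemma conjci : conjc 'i%C = - 'i%C :> R[i].
Proof. by apply/eqP; rewrite eq_complex /= oppr0 eqxx eqxx. Qed.

End Modulus.

(** * The chain in complex coordinates *)

Section Chain.

(** Entries beyond the last site are taken to be 0, so the free boundary
    conditions show only in the diagonal coefficient, the number of neighbours. *)
Definition lapf (K : comPzRingType) (n : nat) (u : nat -> K) (k : nat) : K :=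
  u k.+1 + (if k is k'.+1 then u k' else 0)
  - ((k != 0%N) + (k != n))%:R * u k.

Lemma conjcD (R : rcfType) (z w : R[i]) : conjc (z + w) = conjc z + conjc w.
Proof. exact: rmorphD. Qed.

Lemma conjcN (R : rcfType) (z : R[i]) : conjc (- z) = - conjc z.
Proof. exact: rmorphN. Qed.

Lemma conjcM (R : rcfType) (z w : R[i]) : conjc (z * w) = conjc z * conjc w.
Proof. exact: rmorphM. Qed.

Lemma conjcX (R : rcfType) (z : R[i]) m : conjc (z ^+ m) = conjc z ^+ m.
Proof. exact: rmorphXn. Qed.

Lemma lapf_conj (R : rcfType) n (u : nat -> R[i]) k :
  conjc (lapf n u k) = lapf n (fun j => conjc (u j)) k.
Proof.
rewrite /lapf !conjcD conjcN conjcM conjc_nat.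
by case: k => [|k] //; rewrite conjc0.
Qed.

Definition conjcE := (lapf_conj, conjc_real, conjci, conjc_nat, conjcK,
  conjcN, conjcX, conjcM, conjcD).

(** The discrete Laplacian is symmetric up to the flux through the last bond;
    that flux vanishes at [m = n], where the far entries are 0. *)
Lemma lapf_flux (K : comPzRingType) n (a b : nat -> K) m :
  \sum_(k < m.+1) (b k * lapf n a k - a k * lapf n b k)
  = b m * a m.+1 - a m * b m.+1.
Proof.
elim: m => [|m IH].
  by rewrite big_ord_recr big_ord0 /= /lapf; ring.
by rewrite big_ord_recr /= IH /lapf; ring.
Qed.

Variable R : rcfType.
Implicit Types (eps gamma omega beta : R) (u x y : nat -> R[i]).

(** The diagonal real coefficients of the drive and of the damping. *)
Definition forcing n beta gamma k : R :=
  beta * (k == 0%N)%:R - gamma * (k == n)%:R.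

(** The field in the variable [u = p + iq]: the coupling, the frequency and the
    cubic term are purely imaginary multiples, only [forcing] is real. *)
Definition chain_field n eps gamma omega beta u k : R[i] :=
  - 'i%C * eps%:C%C * lapf n u k - 'i%C * omega%:C%C * u k
  + 'i%C * (u k * conjc (u k)) * u k + (forcing n beta gamma k)%:C%C * u k.

(** The derivative of [chain_field] at [u] in the direction [x], with the
    conjugate of the increment replaced by an independent unknown [y]; this makes
    it complex linear, as needed for complex eigenvectors. *)
Definition chain_lin n eps gamma omega beta u x y k : R[i] :=
  - 'i%C * eps%:C%C * lapf n x k - 'i%C * omega%:C%C * x k
  + 2%:R * 'i%C * (u k * conjc (u k)) * x k + 'i%C * u k ^+ 2 * y k
  + (forcing n beta gamma k)%:C%C * x k.

Definition chain_lin_conj n eps gamma omega beta u x y k : R[i] :=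
  'i%C * eps%:C%C * lapf n y k + 'i%C * omega%:C%C * y k
  - 2%:R * 'i%C * (u k * conjc (u k)) * y k - 'i%C * conjc (u k) ^+ 2 * x k
  + (forcing n beta gamma k)%:C%C * y k.

Lemma chain_lin_conjE n eps gamma omega beta u x y k :
  conjc (chain_lin n eps gamma omega beta u x y k) =
  chain_lin_conj n eps gamma omega beta u (fun j => conjc (y j))
    (fun j => conjc (x j)) k.
Proof.
rewrite /chain_lin /chain_lin_conj !conjcE; ring.
Qed.

Definition chain_stationary n eps gamma omega beta u :=
  (forall k, (n < k)%N -> u k = 0) /\
  (forall k, (k <= n)%N -> chain_field n eps gamma omega beta u k = 0).

Definition chain_eigen n eps gamma omega beta u (z : R[i]) x y :=
  (forall k, (n < k)%N -> x k = 0 /\ y k = 0) /\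
  (forall k, (k <= n)%N ->
     chain_lin n eps gamma omega beta u x y k = z * x k /\
     chain_lin_conj n eps gamma omega beta u x y k = z * y k).

(** Complex conjugation exchanges the two resonances [z] near [i] and [z] near
    [-i], so only the second one has to be studied. *)
Lemma chain_eigen_conj n eps gamma omega beta u z x y :
  chain_eigen n eps gamma omega beta u z x y ->
  chain_eigen n eps gamma omega beta u (conjc z)
    (fun k => conjc (y k)) (fun k => conjc (x k)).
Proof.
move=> [hout hin]; split=> k kn.
  by have [-> ->] := hout k kn; rewrite conjc0.
have [hx hy] := hin k kn.
split; last first.
  by rewrite -chain_lin_conjE hx rmorphM.
rewrite -[LHS]conjcK chain_lin_conjE -rmorphM -hy; congr conjc.
rewrite /chain_lin_conj /lapf !conjcK.
by case: k {kn hx hy} => [|k]; rewrite ?conjcK.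
Qed.

Lemma sum_forcing n beta gamma (f : nat -> R) : (0 < n)%N ->
  \sum_(k < n.+1) forcing n beta gamma k * f k = beta * f 0%N - gamma * f n.
Proof.
case: n => // n _; rewrite big_ord_recl big_ord_recr /= /forcing /=.
rewrite big1 ?add0r => [|i _]; first by rewrite /bump /= add1n !eqxx /=; ring.
by rewrite /bump /= add1n eqSS (ltn_eqF (ltn_ord i)) !mulr0 subr0 mul0r.
Qed.

End Chain.

(** * Balance of charge and of power *)

Section Balance.
Variable R : rcfType.
Implicit Types (eps gamma omega beta : R) (u x y : nat -> R[i]).

(** Both sides are half the rate of change of the charge
    [\sum_k (|x k|^2 - |y k|^2)]: the coupling telescopes by [lapf_flux], the
    terms in [u] cancel between the equations of [x] and [y], and only the real
    coefficients [forcing] contribute. *)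
Lemma charge_balance n eps gamma omega beta u z x y : (0 < n)%N ->
  chain_eigen n eps gamma omega beta u z x y ->
  complex.Re z * (\sum_(k < n.+1) (modulus (x k) ^+ 2 - modulus (y k) ^+ 2))
  = beta * (modulus (x 0%N) ^+ 2 - modulus (y 0%N) ^+ 2)
    - gamma * (modulus (x n) ^+ 2 - modulus (y n) ^+ 2).
Proof.
move=> n0 [hout hin].
rewrite -(sum_forcing beta gamma (fun k => modulus (x k) ^+ 2 - modulus (y k) ^+ 2)) //.
have [xn yn] := hout n.+1 (ltnSn n).
apply: complexI; rewrite rmorphM /= !rmorph_sum /= mulr_sumr.
have two : (2%:R : R[i]) != 0 by rewrite pnatr_eq0.
apply: (mulfI two); rewrite !mulr_sumr.
have fx := lapf_flux n x (fun k => conjc (x k)) n.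
have fy := lapf_flux n y (fun k => conjc (y k)) n.
rewrite xn conjc0 !mulr0 subr0 in fx.
rewrite yn conjc0 !mulr0 subr0 in fy.
(* add the two vanishing coupling sums; the identity then holds site by site *)
have -> : \sum_(k < n.+1) 2%:R * (forcing n beta gamma k *
    (modulus (x k) ^+ 2 - modulus (y k) ^+ 2))%:C%C
  = \sum_(k < n.+1) 2%:R * (forcing n beta gamma k *
    (modulus (x k) ^+ 2 - modulus (y k) ^+ 2))%:C%C
    - 'i%C * eps%:C%C * (\sum_(k < n.+1) (conjc (x k) * lapf n x k
        - x k * lapf n (fun k => conjc (x k)) k))
    - 'i%C * eps%:C%C * (\sum_(k < n.+1) (conjc (y k) * lapf n y k
        - y k * lapf n (fun k => conjc (y k)) k)).
  by rewrite fx fy !mulr0 !subr0.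
rewrite !mulr_sumr -!sumrB; apply: eq_bigr => k _.
have kn : (k <= n)%N by rewrite -ltnS.
have [hx hy] := hin _ kn.
have hx' := congr1 (@conjc R) hx; have hy' := congr1 (@conjc R) hy.
rewrite rmorphM /= in hx'; rewrite rmorphM /= in hy'.
have Ez : 2%:R * (complex.Re z)%:C%C = z + conjc z by rewrite addcJ.
have forcingE (d a b : R) : (d * (a - b))%:C%C = d%:C%C * (a%:C%C - b%:C%C).
  by rewrite rmorphM rmorphB.
rewrite mulrA Ez forcingE rmorphB /= -!mul_conjc.
transitivity (conjc (x k) * (z * x k) + x k * (conjc z * conjc (x k))
  - conjc (y k) * (z * y k) - y k * (conjc z * conjc (y k))); first by ring.
rewrite -hx -hy -hx' -hy' /chain_lin /chain_lin_conj.
rewrite !conjcE; ring.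
Qed.

(** The total power vanishes at a stationary state: what is fed in at the
    driven end is dissipated at the damped end. *)
Lemma power_balance n eps gamma omega beta u : (0 < n)%N ->
  chain_stationary n eps gamma omega beta u ->
  beta * modulus (u 0%N) ^+ 2 = gamma * modulus (u n) ^+ 2.
Proof.
move=> n0 [hout hin].
apply/eqP; rewrite -subr_eq0; apply/eqP.
rewrite -(sum_forcing beta gamma (fun k => modulus (u k) ^+ 2)) //.
have un := hout n.+1 (ltnSn n).
apply: complexI; rewrite rmorph_sum /= rmorph0.
have two : (2%:R : R[i]) != 0 by rewrite pnatr_eq0.
apply: (mulfI two); rewrite !mulr_sumr mulr0.
have fu := lapf_flux n u (fun k => conjc (u k)) n.
rewrite un conjc0 !mulr0 subr0 in fu.
have -> : \sum_(k < n.+1) 2%:R * (forcing n beta gamma k * modulus (u k) ^+ 2)%:C%C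
  = \sum_(k < n.+1) 2%:R * (forcing n beta gamma k * modulus (u k) ^+ 2)%:C%C
    - 'i%C * eps%:C%C * (\sum_(k < n.+1) (conjc (u k) * lapf n u k
        - u k * lapf n (fun k => conjc (u k)) k)).
  by rewrite fu mulr0 subr0.
rewrite mulr_sumr -sumrB; apply: big1 => k _.
have kn : (k <= n)%N by rewrite -ltnS.
have hu := hin _ kn; have hu' := congr1 (@conjc R) hu.
rewrite (rmorphM _ (forcing _ _ _ _)) /= -mul_conjc.
transitivity (conjc (u k) * chain_field n eps gamma omega beta u k
   + u k * conjc (chain_field n eps gamma omega beta u k)); last first.
  by rewrite hu conjc0 !mulr0 addr0.
rewrite /chain_field !conjcE; ring.
Qed.

End Balance.

(** * Weakly coupled recurrences *)

Section Decay.
Variable R : realFieldType.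

(** With zero beyond the far end the recurrence can be solved from that end: the
    coupling to the far neighbour is absorbed into a factor 2, and each entry is
    controlled by the near neighbour alone. *)
Lemma absorb_far_neighbour (n : nat) (theta : R) (a s : nat -> R) :
  0 <= theta -> theta <= 4^-1 -> (forall k, 0 <= a k) ->
  (forall k, 0 <= s k) -> (forall k, s k.+1 <= s k) ->
  a n.+1 = 0 ->
  (forall k, (k < n)%N -> a k.+1 <= theta * (a k + a k.+2) + s k.+1) ->
  forall k, (k < n)%N -> a k.+1 <= 2 * theta * a k + 2 * s k.+1.
Proof.
move=> th0 th1 a0 s0 sd an rec.
have step m : forall k, (k + m).+1 = n -> a k.+1 <= 2 * theta * a k + 2 * s k.+1.
  elim: m => [|m IH] k kE.
    have kn : (k < n)%N by lia.
    have := rec _ kn; rewrite (_ : k.+2 = n.+1); last by lia.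
    rewrite an; have := s0 k.+1; have := a0 k; nra.
  have kn : (k < n)%N by lia.
  have h := rec _ kn.
  have h2 := IH k.+1 ltac:(lia).
  have h3 := sd k.+1; have h4 := s0 k.+2; have h5 := a0 k; have h6 := a0 k.+1.
  have h7 : theta * a k.+2 <= theta * (2 * theta * a k.+1 + 2 * s k.+1).
    by apply: ler_wpM2l => //; lra.
  have h8 : 0 <= theta * a k by apply: mulr_ge0.
  have h9 : theta * theta * a k.+1 <= 16^-1 * a k.+1.
    by apply: ler_wpM2r => //; nra.
  have h10 : theta * s k.+1 <= 4^-1 * s k.+1 by apply: ler_wpM2r => //; lra.
  nra.
by move=> k kn; apply: (step (n - k.+1)%N); lia.
Qed.

(** Here [a] and [b] stand for the moduli of the resonant and of the
    nonresonant component of a mode, and [U k] for [|u k|^2].  Read from the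
    damped end, the resonant recurrence loses at most a factor [t] per site, so
    [a n] is at least about [t^(n-1)] times the largest entry [M].  The
    nonresonant component is driven only through the head and through [U], hence
    decays like [t (4t)^k M] and is negligible at every site, including the last
    one, where it is of order [t^2] relative to [a n]. *)
Lemma mode_profile (n : nat) (t tau : R) (a b U : nat -> R) :
  (0 < n)%N -> 0 < t -> t <= tau -> 16 ^+ n * tau <= 200^-1 ->
  (forall k, 0 <= a k) -> (forall k, 0 <= b k) -> (forall k, 0 <= U k) ->
  a n.+1 = 0 -> b n.+1 = 0 ->
  (forall k, (k <= n)%N -> U k <= 2 * (16 * t ^+ 2) ^+ k) ->
  (forall k, (k < n)%N ->
    b k.+1 <= t * (b k + b k.+2) + U k.+1 * a k.+1) ->
  (forall k, (k < n)%N ->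
    t * a k <= t * a k.+2 + 23 * tau * a k.+1 + U k.+1 * b k.+1) ->
  a 0%N + b 0%N <= 6 * t * b 1%N + 2 * t * a 1%N ->
  (exists2 k, (k <= n)%N & 0 < a k + b k) ->
  [/\ 0 < a n, b n <= a n / 2,
      ((4 * t) ^+ n * a 0%N) ^+ 2 <= a n ^+ 2 / 4 &
      0 < \sum_(k < n.+1) (a k ^+ 2 - b k ^+ 2)].
Proof.
move=> n0 t0 ttau tau16 a_ge0 b_ge0 U_ge0 an bn Ubd recb reca head [k0 k0n nz].
have t0' := ltW t0; have tau0 : 0 < tau by lra.
have tau0' := ltW tau0.
have e16 : 1 <= 16 ^+ n :> R by apply: exprn_ege1; lra.
have tau1 : tau <= 200^-1 by nra.
have t1 : t <= 200^-1 by lra.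
have tt : t * t <= 200^-1 * t by rewrite ler_wpM2r //.
have [m [mn Mmax]] : exists m : nat, (m <= n)%N /\ forall k, (k <= n)%N -> a k <= a m.
  pose m0 := [arg max_(i > (ord0 : 'I_n.+1)) a i]%O.
  exists m0; split; first by rewrite -ltnS.
  move=> k kn; rewrite /m0; case: arg_maxP => //= i _ hi.
  by have := hi (Ordinal (kn : (k < n.+1)%N)) isT.
set M := a m in Mmax.
have M0 : 0 <= M by exact: a_ge0.
(* bound for the source term in the recurrence of b *)
pose s k := 2 * (16 * t ^+ 2) ^+ k * M.
have q0 : 0 <= 16 * t ^+ 2 by rewrite mulr_ge0 ?sqr_ge0.
have q1 : 16 * t ^+ 2 <= 1 by rewrite expr2; lra.
have s_ge0 k : 0 <= s k by rewrite /s !mulr_ge0 // exprn_ge0.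
have b_fwd : forall k, (k < n)%N -> b k.+1 <= 2 * t * b k + 2 * s k.+1.
  apply: (absorb_far_neighbour (n := n)) => //; try lra.
    move=> k; rewrite /s exprS; apply: ler_wpM2r => //.
    by rewrite ler_wpM2l // ler_piMl // exprn_ge0.
  move=> k kn; apply: le_trans (recb _ kn) _; rewrite lerD2l.
  by apply: ler_pM => //; [exact: Ubd | exact: Mmax].
have tM : 0 <= t * M by rewrite mulr_ge0.
have head' : a 0%N + b 0%N <= 8 * (t * M).
  have h1 := b_fwd 0%N n0; rewrite /s expr1 expr2 in h1.
  have h2 : t * a 1%N <= t * M by rewrite ler_wpM2l // Mmax.
  have h3 : t * b 1%N <= t * (2 * t * b 0%N + 2 * (2 * (16 * (t * t)) * M)).
    by rewrite ler_wpM2l.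
  have h4 : t * t * b 0%N <= 200^-1 * b 0%N.
    by rewrite ler_wpM2r //; lra.
  have h5 : t * t * (t * M) <= 200^-1 * (t * M).
    by rewrite ler_wpM2r //; lra.
  have h6 := a_ge0 0%N; lra.
have b_all : forall k, (k <= n)%N -> b k <= 32 * t * (4 * t) ^+ k * M.
  elim=> [_|k IH kn]; first by rewrite expr0; have := a_ge0 0%N; lra.
  apply: le_trans (b_fwd _ kn) _.
  have h1 : t * b k <= t * (32 * t * (4 * t) ^+ k * M).
    by rewrite ler_wpM2l // IH // ltnW.
  have h2 : s k.+1 <= 8 * t * (4 * t) ^+ k.+1 * M.
    rewrite /s; apply: ler_wpM2r => //.
    have -> : 16 * t ^+ 2 = 4 * t * (4 * t) by rewrite expr2; ring.
    rewrite exprMn.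
    have p0 : 0 <= (4 * t) ^+ k.+1 by rewrite exprn_ge0 //; lra.
    have p1 : (4 * t) ^+ k.+1 <= 4 * t.
      by rewrite exprS ler_piMr ?exprn_ile1 //; lra.
    have : (4 * t) ^+ k.+1 * (4 * t) ^+ k.+1 <= 4 * t * (4 * t) ^+ k.+1.
      by rewrite ler_wpM2r.
    lra.
  rewrite exprS; rewrite exprS in h2; lra.
(* the second term of E absorbs the contribution of b to the recurrence of a *)
pose E := a n + t ^+ n.+1 * M.
have tnM : 0 <= t ^+ n.+1 * M by rewrite mulr_ge0 // exprn_ge0 //.
have E0 : 0 <= E by rewrite addr_ge0.
have a_all : forall j k, (k + j)%N = n -> (0 < k)%N -> t ^+ j * a k <= E.
  elim/ltn_ind => -[|j] IH k kj kpos.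
    rewrite expr0 mul1r; rewrite addn0 in kj; rewrite kj.
    by rewrite lerDl.
  have kn : (k < n)%N by move: kj; clear; lia.
  have tj : 0 <= t ^+ j by rewrite exprn_ge0 //.
  have h0 : t ^+ j * (t * a k) <=
      t ^+ j * (t * a k.+2 + 23 * tau * a k.+1 + U k.+1 * b k.+1).
    by rewrite ler_wpM2l // reca.
  have h1 : t ^+ j * a k.+1 <= E by apply: IH => //; move: kj; clear; lia.
  have h2 : t * (t ^+ j * a k.+2) <= t * t * E.
    rewrite -mulrA ler_wpM2l //.
    case: j IH kj {tj h0 h1} => [|j] IH kj.
      by rewrite (_ : k.+2 = n.+1) ?an ?mulr0 ?mulr_ge0 //; move: kj; clear; lia.
    by rewrite exprS -mulrA ler_wpM2l // IH //; move: kj; clear; lia.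
  have h3 : t ^+ j * (U k.+1 * b k.+1) <= 2^-1 * (t ^+ n.+1 * M).
    apply: (@le_trans _ _ (t ^+ j *
        (2 * (16 * t ^+ 2) ^+ k.+1 * (32 * t * (4 * t) ^+ k.+1 * M)))).
      by rewrite ler_wpM2l // ler_pM // ?Ubd ?b_all.
    have -> : n.+1 = (j + (k.+1 + 1))%N by move: kj; clear; lia.
    have -> : t ^+ j * (2 * (16 * t ^+ 2) ^+ k.+1 * (32 * t * (4 * t) ^+ k.+1 * M))
        = 64 * (64 * (t * t)) ^+ k.+1 * (t ^+ (j + (k.+1 + 1)) * M).
      have -> : 64 * (t * t) = 16 * 4 * t ^+ 2 by rewrite expr2; ring.
      by rewrite !exprD expr1 !exprMn; ring.
    apply: ler_wpM2r; first by rewrite mulr_ge0 // exprn_ge0 //.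
    have r0 : 0 <= 64 * (t * t) by rewrite !mulr_ge0 //.
    have : (64 * (t * t)) ^+ k.+1 <= 64 * (t * t).
      by rewrite exprS ler_piMr ?exprn_ile1 //; lra.
    lra.
  have h4 : t * t * E <= 200^-1 * E by rewrite ler_wpM2r //; lra.
  have h5 : tau * E <= 200^-1 * E by rewrite ler_wpM2r.
  have h6 : tau * (t ^+ j * a k.+1) <= tau * E by rewrite ler_wpM2l.
  have h7 : t ^+ n.+1 * M <= E by rewrite lerDr.
  rewrite exprS; lra.
(* if M were 0, the bound b_all would make b vanish as well *)
have M_gt0 : 0 < M.
  rewrite lt_def M0 andbT; apply: contraTneq nz => M00.
  rewrite -leNgt; have := Mmax _ k0n; have := b_all _ k0n.
  rewrite M00 mulr0; lra.
(* the maximum is not at the head, where a is at most 8 t M *)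
have m0 : (0 < m)%N.
  rewrite lt0n; apply: contraTneq M_gt0 => m0; rewrite -leNgt.
  have : M <= 8 * (t * M) by rewrite {1}/M m0; have := b_ge0 0%N; lra.
  have : t * M <= 200^-1 * M by rewrite ler_wpM2r.
  lra.
have EE : E = a n + t ^+ n.+1 * M by [].
case: n n0 mn m0 an bn Ubd recb reca k0n e16 tau16 Mmax b_fwd b_all E EE tnM E0 a_all
  => // n _ mn m0 an bn Ubd recb reca k0n e16 tau16 Mmax b_fwd b_all E EE tnM E0 a_all.
pose W := t ^+ n * M.
have W0 : 0 < W by rewrite mulr_gt0 // exprn_gt0.
have W0' := ltW W0.
have Wa : W <= 2 * a n.+1.
  have h1 : W <= E.
    apply: le_trans (a_all (n.+1 - m)%N m _ m0); last by move: mn; clear; lia.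
    rewrite /W -/M; apply: ler_wpM2r => //.
    by apply: ler_wiXn2l; [| lra | move: m0; clear; lia].
  have h2 : t ^+ n.+2 * M = t * t * W by rewrite /W !exprS; ring.
  have h3 : t * t * W <= 200^-1 * W by rewrite ler_wpM2r //; lra.
  by rewrite EE h2 in h1; lra.
have f4 : 4 ^+ n.+1 <= 16 ^+ n.+1 :> R by apply: lerXn2r; rewrite ?nnegrE; lra.
have f4t : 4 ^+ n.+1 * t <= 200^-1.
  apply: le_trans tau16; apply: ler_pM => //; exact: exprn_ge0.
have p4 : (4 * t) ^+ n.+1 * M = 4 ^+ n.+1 * t * W.
  by rewrite exprMn /W (exprS t); ring.
have p4' : (4 * t) ^+ n.+1 * M <= 200^-1 * W by rewrite p4 ler_wpM2r //.
split.
- lra.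
- have := b_all _ (leqnn n.+1); rewrite -mulrA.
  have : 32 * t * ((4 * t) ^+ n.+1 * M) <= 1 * (200^-1 * W).
    apply: ler_pM => //; rewrite ?mulr_ge0 ?exprn_ge0 ?mulr_ge0 //; lra.
  lra.
- have -> : a n.+1 ^+ 2 / 4 = (a n.+1 / 2) ^+ 2 by rewrite exprMn exprVn; congr (_ / _); ring.
  have h1 : (4 * t) ^+ n.+1 * a 0%N <= (4 * t) ^+ n.+1 * M.
    by rewrite ler_wpM2l ?Mmax // exprn_ge0 // mulr_ge0 //.
  have h2 : 0 <= (4 * t) ^+ n.+1 * a 0%N.
    by rewrite mulr_ge0 // exprn_ge0 // mulr_ge0 //.
  by apply: lerXn2r; rewrite ?nnegrE //; lra.
- rewrite sumrB subr_gt0.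
  have h1 : M ^+ 2 <= \sum_(k < n.+2) a k ^+ 2.
    rewrite (bigD1 (Ordinal (mn : (m < n.+2)%N))) //= lerDl.
    by apply: sumr_ge0 => i _; exact: sqr_ge0.
  apply: lt_le_trans h1.
  have h2 : \sum_(k < n.+2) b k ^+ 2 <= \sum_(k < n.+2) (32 * (t * M)) ^+ 2.
    apply: ler_sum => k _; have kn : (k <= n.+1)%N by rewrite -ltnS.
    apply: lerXn2r; rewrite ?nnegrE //; first by rewrite mulr_ge0.
    apply: le_trans (b_all _ kn) _.
    rewrite -!mulrA ler_wpM2l // ler_wpM2l // ler_piMl //.
    by apply: exprn_ile1; lra.
  apply: le_lt_trans h2 _; rewrite sumr_const card_ord -(mulr_natl _ n.+2).
  have h3 : n.+2%:R <= 16 ^+ n.+1 :> R by rewrite -natrX ler_nat ltn_expl.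
  have h4 : n.+2%:R * t <= 200^-1.
    by apply: le_trans tau16; apply: ler_pM.
  have -> : n.+2%:R * (32 * (t * M)) ^+ 2 = 32 * 32 * (n.+2%:R * t) * t * M ^+ 2.
    by rewrite !expr2; ring.
  rewrite -[ltRHS]mul1r ltr_pM2r ?exprn_gt0 //.
  have : n.+2%:R * t * t <= 200^-1 * 1 by apply: ler_pM => //; rewrite ?mulr_ge0 //; lra.
  have : n.+2%:R * t * t <= 200^-1 * t by rewrite ler_wpM2r.
  lra.
Qed.

End Decay.

(** * Stationary amplitudes of a weakly coupled chain *)

Section Sites.
Variable R : rcfType.
Variables (n : nat) (tau eps gamma omega beta : R) (u : nat -> R[i]).

(** The parameters and the state are within [tau] of the base point; site 0 is
    compared with 1 and the others with 0. *)
Record near_single_site : Prop := NearSingleSite {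
  nss_eps : `|eps| <= tau;
  nss_gamma0 : 0 < gamma;
  nss_gamma : gamma <= tau;
  nss_omega : `|omega - 1| <= tau;
  nss_head : modulus (u 0%N - 1) <= tau;
  nss_tail : forall k, (0 < k)%N -> modulus (u k) <= tau }.

Hypothesis n_gt0 : (0 < n)%N.
Hypothesis tau_small : tau <= 200^-1.
Hypothesis near : near_single_site.
Hypothesis stat : chain_stationary n eps gamma omega beta u.

Lemma tau_ge0 : 0 <= tau.
Proof. by have := nss_eps near; have := normr_ge0 eps; lra. Qed.

Lemma head_le : modulus (u 0%N) <= 1 + tau.
Proof.
have -> : u 0%N = 1 + (u 0%N - 1) by ring.
apply: le_trans (modulusD _ _) _.
by rewrite (modulus_nat R 1); have := nss_head near; lra.
Qed.

Lemma head_ge : 1 - tau <= modulus (u 0%N).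
Proof.
have ts := tau_small; have tp := tau_ge0.
have h : modulus (1 : R[i]) <= modulus (u 0%N) + modulus (u 0%N - 1).
  by have := modulusB (u 0%N) (u 0%N - 1); rewrite opprB addrC addrNK.
by rewrite (modulus_nat R 1) in h; have := nss_head near; lra.
Qed.

(** The deviation from the uncoupled frequency 1 of a site, without the
    contribution of the cubic term. *)
Definition detuning k : R := ((k != 0%N) + (k != n))%:R * eps + (1 - omega).

Lemma detuningE k : (detuning k)%:C%C =
  ((k != 0%N) + (k != n))%:R * eps%:C%C + (1 - omega%:C%C).
Proof. by rewrite /detuning rmorphD rmorphB rmorphM rmorph_nat rmorph1. Qed.

Lemma detuning_le k : `|detuning k| <= 3 * tau.
Proof.
apply: le_trans (ler_normD _ _) _; rewrite distrC normrM normr_nat.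
have h1 := nss_eps near; have h2 := nss_omega near.
have h3 : ((k != 0%N) + (k != n))%:R * `|eps| <= 2 * tau.
  by apply: ler_pM => //; rewrite ler_nat; case: (k != 0%N) (k != n) => [] [].
by lra.
Qed.

Lemma beta_head : beta * modulus (u 0%N) ^+ 2 = gamma * modulus (u n) ^+ 2.
Proof. exact: power_balance n_gt0 stat. Qed.

Lemma beta_ge0 : 0 <= beta.
Proof.
have ts := tau_small; have tp := tau_ge0.
have h := beta_head; have h1 := head_ge.
have h0 : 0 < modulus (u 0%N) ^+ 2 by apply: exprn_gt0; lra.
by rewrite -(pmulr_lge0 _ h0) h mulr_ge0 ?exprn_ge0 ?modulus_ge0 // ltW // nss_gamma0.
Qed.

Lemma beta_le : beta <= tau.
Proof.
have ts := tau_small; have tp := tau_ge0.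
have h := beta_head; have h1 := head_ge; have b0 := beta_ge0.
have h2 := nss_tail near n_gt0; have g := nss_gamma near; have g0 := nss_gamma0 near.
have m0 := modulus_ge0 (u n).
rewrite !expr2 in h.
have h3 : beta * (1 - tau) * (1 - tau) <= beta * (modulus (u 0%N) * modulus (u 0%N)).
  by rewrite -mulrA; apply: ler_wpM2l => //; apply: ler_pM => //; lra.
have h4 : gamma * (modulus (u n) * modulus (u n)) <= tau * (tau * tau).
  by apply: ler_pM; rewrite ?mulr_ge0 ?(ltW g0) //; apply: ler_pM.
have h5 : tau * (tau * tau) <= tau * (200^-1 * 200^-1).
  by apply: ler_wpM2l => //; apply: ler_pM.
have h6 : beta * ((199 / 200) * (199 / 200)) <= beta * (1 - tau) * (1 - tau).
  by rewrite -[beta * _ * _]mulrA; apply: ler_wpM2l => //; apply: ler_pM; lra.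
lra.
Qed.

Lemma forcing_le k : `|forcing n beta gamma k| <= tau.
Proof.
have b0 := beta_ge0; have b1 := beta_le.
have g0 := nss_gamma0 near; have g1 := nss_gamma near.
rewrite /forcing; have [->|k0] := eqVneq k 0%N; last first.
  have tp := tau_ge0; rewrite mulr0 sub0r normrN.
  by case: (k == n); rewrite ?mulr1 ?mulr0 ?normr0 // gtr0_norm.
have -> : (0%N == n) = false by rewrite eq_sym; apply/negbTE; rewrite -lt0n.
by rewrite mulr0 subr0 mulr1 ger0_norm.
Qed.

(** The common form of the diagonal coefficients of the linearized equations,
    once their value at the base point is subtracted. *)
Lemma coef_le (d f : R) (g : R[i]) : `|d| <= 3 * tau -> `|f| <= tau ->
  modulus g <= 3 * tau ->
  modulus ('i%C * d%:C%C + 2%:R * 'i%C * g + f%:C%C) <= 10 * tau.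
Proof.
move=> hd hf hg.
apply: le_trans (modulusD _ _) _.
have := modulusD ('i%C * d%:C%C) (2%:R * 'i%C * g).
by rewrite !modulusM !modulus_real modulusi modulus_nat; lra.
Qed.

Lemma modulus_tail_sq k : (0 < k)%N -> modulus (u k) ^+ 2 <= 3 * tau.
Proof.
have ts := tau_small; have tp := tau_ge0.
move=> k0; have h := nss_tail near k0; have m0 := modulus_ge0 (u k).
have : modulus (u k) * modulus (u k) <= 1 * tau by apply: ler_pM => //; lra.
by rewrite -expr2; lra.
Qed.

Lemma modulus_head_sq1 : modulus (u 0%N ^+ 2 - 1) <= 3 * tau.
Proof.
have ts := tau_small; have tp := tau_ge0.
have -> : u 0%N ^+ 2 - 1 = (u 0%N - 1) * (u 0%N + 1) by ring.
rewrite modulusM.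
have h1 := modulusD (u 0%N) 1; rewrite (modulus_nat R 1) in h1.
have h2 := head_le; have h3 := nss_head near.
by rewrite (mulrC 3); apply: ler_pM; rewrite ?modulus_ge0 //; lra.
Qed.

Lemma modulus_head_normsq1 : modulus (u 0%N * conjc (u 0%N) - 1) <= 3 * tau.
Proof.
have ts := tau_small; have tp := tau_ge0.
have -> : u 0%N * conjc (u 0%N) - 1 =
    (u 0%N - 1) * conjc (u 0%N) + conjc (u 0%N - 1).
  by rewrite !conjcE; ring.
apply: le_trans (modulusD _ _) _; rewrite modulusM !modulusJ.
have h2 := head_le; have h3 := nss_head near.
have : modulus (u 0%N - 1) * modulus (u 0%N) <= tau * 2.
  by apply: ler_pM; rewrite ?modulus_ge0 //; lra.
lra.
Qed.

(** Away from the driven site the frequency term dominates the stationarity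
    equation, which is therefore a weakly coupled recurrence for [u]. *)
Lemma amplitude_decay k : (k < n)%N ->
  modulus (u k.+1) <= 4 * `|eps| * modulus (u k).
Proof.
have ts := tau_small; have tp := tau_ge0.
move=> kn; have [out eqs] := stat.
have t1 : `|eps| <= 200^-1 by have := nss_eps near; lra.
have -> : 4 * `|eps| * modulus (u k)
    = 2 * (2 * `|eps|) * modulus (u k) + 2 * (fun=> 0) k.+1 by rewrite mulr0; ring.
move: k kn; apply: (absorb_far_neighbour (n := n) (theta := 2 * `|eps|)
  (a := fun k => modulus (u k)) (s := fun=> 0)) => //.
- lra.
- by move=> k; exact: modulus_ge0.
- by rewrite out // modulus0.
move=> k kn; have e := eqs _ kn.
have E : u k.+1 = ((detuning k.+1)%:C%C + u k.+1 * conjc (u k.+1)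
    + (- 'i%C) * (forcing n beta gamma k.+1)%:C%C) * u k.+1
    - eps%:C%C * (u k + u k.+2).
  apply/eqP; rewrite -subr_eq0; apply/eqP.
  transitivity ('i%C * chain_field n eps gamma omega beta u k.+1); last first.
    by rewrite e mulr0.
  rewrite /chain_field /lapf detuningE.
  have i2 := sqr_i R; rewrite expr2 in i2; ring: i2.
have h1 := modulusB (((detuning k.+1)%:C%C + u k.+1 * conjc (u k.+1)
    + (- 'i%C) * (forcing n beta gamma k.+1)%:C%C) * u k.+1)
    (eps%:C%C * (u k + u k.+2)).
rewrite -E !modulusM modulus_real in h1.
have h2 := modulusD ((detuning k.+1)%:C%C + u k.+1 * conjc (u k.+1))
   ((- 'i%C) * (forcing n beta gamma k.+1)%:C%C).
have h3 := modulusD ((detuning k.+1)%:C%C) (u k.+1 * conjc (u k.+1)).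
rewrite !modulusM modulusJ modulusN modulusi !modulus_real -expr2 in h2 h3.
have h4 := detuning_le k.+1; have h5 := modulus_tail_sq (ltn0Sn k).
have h6 := forcing_le k.+1; have h7 := modulusD (u k) (u k.+2).
have m0 := modulus_ge0 (u k.+1).
set X := modulus (_ + _ + _) in h1 h2.
have h8 : X * modulus (u k.+1) <= 2^-1 * modulus (u k.+1).
  by apply: ler_wpM2r => //; lra.
have h9 : `|eps| * modulus (u k + u k.+2) <= `|eps| * (modulus (u k) + modulus (u k.+2)).
  by apply: ler_wpM2l.
lra.
Qed.

Lemma amplitude_le k : (k <= n)%N -> modulus (u k) <= (4 * `|eps|) ^+ k * modulus (u 0%N).
Proof.
elim: k => [|k IH] kn; first by rewrite expr0 mul1r.
apply: le_trans (amplitude_decay kn) _; rewrite exprS -[leRHS]mulrA.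
by apply: ler_wpM2l; [rewrite mulr_ge0 | exact: IH (ltnW kn)].
Qed.

Lemma amplitude_sq_le k : (k <= n)%N ->
  modulus (u k) ^+ 2 <= 2 * (16 * `|eps| ^+ 2) ^+ k.
Proof.
have ts := tau_small; have tp := tau_ge0.
move=> kn; have h := amplitude_le kn; have h0 := head_le.
have m0 := modulus_ge0 (u k); have m1 := modulus_ge0 (u 0%N).
have q0 : 0 <= (4 * `|eps|) ^+ k by rewrite exprn_ge0 // mulr_ge0.
have -> : 16 * `|eps| ^+ 2 = (4 * `|eps|) * (4 * `|eps|) by ring.
rewrite exprMn.
have h1 : modulus (u k) ^+ 2 <= ((4 * `|eps|) ^+ k * modulus (u 0%N)) ^+ 2.
  by apply: lerXn2r; rewrite ?nnegrE ?mulr_ge0.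
have h2 : modulus (u 0%N) * modulus (u 0%N) <= 2.
  have : modulus (u 0%N) * modulus (u 0%N) <= (1 + tau) * (1 + tau).
    by apply: ler_pM.
  have : tau * tau <= 200^-1 * tau by apply: ler_wpM2r.
  lra.
apply: le_trans h1 _; rewrite exprMn !expr2 mulrC.
by apply: ler_wpM2r => //; rewrite mulr_ge0.
Qed.

(** The power balance combined with the decay of the amplitudes. *)
Lemma beta_le_gamma : beta <= gamma * ((4 * `|eps|) ^+ n) ^+ 2.
Proof.
have ts := tau_small; have tp := tau_ge0.
have h := beta_head; have h1 := head_ge; have g0 := nss_gamma0 near.
have h0 : 0 < modulus (u 0%N) ^+ 2 by apply: exprn_gt0; lra.
rewrite -(ler_pM2r h0) h -mulrA -exprMn; apply: ler_wpM2l; first exact: ltW.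
by apply: lerXn2r; rewrite ?nnegrE ?mulr_ge0 ?exprn_ge0 ?mulr_ge0 ?modulus_ge0 ?amplitude_le.
Qed.

End Sites.

(** * Location and damping of the oscillating modes *)

Section Modes.
Variable R : rcfType.
Variables (n : nat) (tau eps gamma omega beta : R) (u : nat -> R[i]).
Hypothesis n_gt0 : (0 < n)%N.
Hypothesis tau_small : tau <= 200^-1.
Hypothesis near : near_single_site tau eps gamma omega u.
Hypothesis stat : chain_stationary n eps gamma omega beta u.

(** The two terms of leading order are kept on the left: the first one measures
    the distance of [z] from the resonance, the second one couples to the
    neighbour on the side of the driven site. *)
Lemma mode_tail z x y k : chain_eigen n eps gamma omega beta u z x y ->
  (k < n)%N ->
  modulus ((z + 'i%C) * x k.+1 + 'i%C * eps%:C%C * x k) <=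
  `|eps| * modulus (x k.+2) + 10 * tau * modulus (x k.+1)
  + modulus (u k.+1) ^+ 2 * modulus (y k.+1).
Proof.
move=> [_ eqs] kn; have [e _] := eqs _ kn.
have -> : (z + 'i%C) * x k.+1 + 'i%C * eps%:C%C * x k =
    - 'i%C * eps%:C%C * x k.+2
    + ('i%C * (detuning n eps omega k.+1)%:C%C
       + 2%:R * 'i%C * (u k.+1 * conjc (u k.+1))
       + (forcing n beta gamma k.+1)%:C%C) * x k.+1
    + 'i%C * u k.+1 ^+ 2 * y k.+1.
  rewrite mulrDl -e /chain_lin /lapf detuningE.
  ring.
apply: le_trans (modulusD _ _) _; rewrite !modulusM modulusi mul1r -expr2 lerD2r.
apply: le_trans (modulusD _ _) _; rewrite !modulusM modulusN modulusi mul1r modulus_real.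
rewrite lerD2l; apply: ler_wpM2r; first exact: modulus_ge0.
apply: coef_le.
- exact: detuning_le near _.
- exact: (forcing_le n_gt0 tau_small near stat).
- by rewrite modulusM modulusJ -expr2; apply: (modulus_tail_sq tau_small near).
Qed.

(** At the base point the driven site contributes the nilpotent map
    [(x, y) |-> (i (x + y), - i (x + y))]. *)
Lemma mode_head z x y : chain_eigen n eps gamma omega beta u z x y ->
  modulus (z * x 0%N - 'i%C * (x 0%N + y 0%N)) <=
  `|eps| * modulus (x 1%N) + 10 * tau * modulus (x 0%N)
  + 3 * tau * modulus (y 0%N).
Proof.
move=> [_ eqs]; have [e _] := eqs 0%N (leq0n n).
have n0 : (0%N != n) = true by rewrite eq_sym -lt0n.
have -> : z * x 0%N - 'i%C * (x 0%N + y 0%N) =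
    - 'i%C * eps%:C%C * x 1%N
    + ('i%C * (detuning n eps omega 0)%:C%C
       + 2%:R * 'i%C * (u 0%N * conjc (u 0%N) - 1)
       + (forcing n beta gamma 0)%:C%C) * x 0%N
    + 'i%C * (u 0%N ^+ 2 - 1) * y 0%N.
  rewrite -e /chain_lin /lapf detuningE n0 /=.
  ring.
apply: le_trans (modulusD _ _) _.
rewrite !modulusM modulusi mul1r; apply: lerD; last first.
  apply: ler_wpM2r; first exact: modulus_ge0.
  exact: (modulus_head_sq1 tau_small near).
apply: le_trans (modulusD _ _) _; rewrite !modulusM modulusN modulusi mul1r modulus_real.
rewrite lerD2l; apply: ler_wpM2r; first exact: modulus_ge0.
apply: coef_le.
- exact: detuning_le near _.
- exact: (forcing_le n_gt0 tau_small near stat).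
- exact: (modulus_head_normsq1 tau_small near).
Qed.

Lemma addJi (z : R[i]) : modulus (conjc z + 'i%C) = modulus (z - 'i%C).
Proof. by rewrite -modulusJ !conjcE. Qed.

(** The largest entry of the eigenvector decides.  If it lies at a site other
    than 0, the equation there forces [z] to be close to [-i] or [i]; if it lies
    at site 0, the nilpotency in [mode_head] forces [z^2] to be small, which
    [r <= modulus z] excludes. *)
Lemma eigenvalue_location z x y r :
  0 < r -> r <= 1 -> 56 * tau < r ^+ 2 -> r <= modulus z ->
  chain_eigen n eps gamma omega beta u z x y ->
  (exists2 k, (k <= n)%N & 0 < modulus (x k) + modulus (y k)) ->
  modulus (z + 'i%C) <= 13 * tau \/ modulus (z - 'i%C) <= 13 * tau.
Proof.
move=> r0 r1 tr rz eig [k0 k0n nz]; have ts := tau_small.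
have tp := tau_ge0 near; have t1 := nss_eps near.
have out k : (n < k)%N -> modulus (x k) = 0 /\ modulus (y k) = 0.
  by move=> kn; have [-> ->] := eig.1 _ kn; rewrite modulus0.
pose V k := Num.max (modulus (x k)) (modulus (y k)).
pose m := [arg max_(i > (ord0 : 'I_n.+1)) V i]%O.
have Vmax k : V k <= V m.
  have [kn|kn] := leqP k n.
    rewrite /m; case: arg_maxP => //= i _ hi.
    by have := hi (Ordinal (kn : (k < n.+1)%N)) isT.
  have [a b] := out _ kn; rewrite /V a b maxxx.
  by rewrite le_max modulus_ge0.
have xV k : modulus (x k) <= V m by apply: le_trans (Vmax k); rewrite le_max lexx.
have yV k : modulus (y k) <= V m by apply: le_trans (Vmax k); rewrite le_max lexx orbT.
have V0 : 0 < V m by have := xV k0; have := yV k0; lra.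
have sq k : (0 < k)%N -> modulus (u k) ^+ 2 <= tau.
  move=> kp; have h := nss_tail near kp; have h0 := modulus_ge0 (u k).
  have : modulus (u k) * modulus (u k) <= 1 * tau by apply: ler_pM => //; lra.
  by rewrite -expr2 mul1r.
have tail (z' : R[i]) x' y' k : chain_eigen n eps gamma omega beta u z' x' y' ->
    (forall k, modulus (x' k) <= V m) -> (forall k, modulus (y' k) <= V m) ->
    (k < n)%N -> modulus (x' k.+1) = V m -> modulus (z' + 'i%C) <= 13 * tau.
  move=> eig' xV' yV' kn xm; have h := mode_tail eig' kn.
  have h2 : modulus ((z' + 'i%C) * x' k.+1) <=
      modulus ((z' + 'i%C) * x' k.+1 + 'i%C * eps%:C%C * x' k) + `|eps| * modulus (x' k).
    have := modulusB ((z' + 'i%C) * x' k.+1 + 'i%C * eps%:C%C * x' k) ('i%C * eps%:C%C * x' k).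
    by rewrite addrK (modulusM ('i%C * _)) (modulusM 'i%C) modulusi mul1r modulus_real.
  rewrite modulusM xm in h2; rewrite xm in h.
  have h3 : `|eps| * modulus (x' k) <= tau * V m by apply: ler_pM; rewrite ?modulus_ge0.
  have h4 : `|eps| * modulus (x' k.+2) <= tau * V m by apply: ler_pM; rewrite ?modulus_ge0.
  have h5 : modulus (u k.+1) ^+ 2 * modulus (y' k.+1) <= tau * V m.
    by apply: ler_pM; rewrite ?exprn_ge0 ?modulus_ge0 ?sq.
  by rewrite -(ler_pM2r V0); lra.
have eigJ := chain_eigen_conj eig.
have headcase : modulus (x 0%N) = V m \/ modulus (y 0%N) = V m -> False.
  move=> hm.
  have hx := mode_head eig; have hy := mode_head eigJ.
  set w := x 0%N + y 0%N in hx.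
  have {hy} hy : modulus (z * y 0%N + 'i%C * w) <= 14 * tau * V m.
    have -> : z * y 0%N + 'i%C * w =
       conjc (conjc z * conjc (y 0%N) - 'i%C * (conjc (y 0%N) + conjc (x 0%N))).
      by rewrite !conjcE /w; ring.
    rewrite modulusJ; apply: le_trans hy _; rewrite !modulusJ.
    have h1 : `|eps| * modulus (y 1%N) <= tau * V m by apply: ler_pM; rewrite ?modulus_ge0.
    have h2 : tau * modulus (x 0%N) <= tau * V m by apply: ler_wpM2l.
    have h3 : tau * modulus (y 0%N) <= tau * V m by apply: ler_wpM2l.
    lra.
  have {hx} hx : modulus (z * x 0%N - 'i%C * w) <= 14 * tau * V m.
    apply: le_trans hx _.
    have h1 : `|eps| * modulus (x 1%N) <= tau * V m by apply: ler_pM; rewrite ?modulus_ge0.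
    have h2 : tau * modulus (x 0%N) <= tau * V m by apply: ler_wpM2l.
    have h3 : tau * modulus (y 0%N) <= tau * V m by apply: ler_wpM2l.
    lra.
  (* z w is small because the two head equations cancel in their sum *)
  have hw : modulus (z * w) <= 28 * tau * V m.
    have -> : z * w = (z * x 0%N - 'i%C * w) + (z * y 0%N + 'i%C * w).
      by rewrite /w; ring.
    by apply: le_trans (modulusD _ _) _; lra.
  have Z0 := modulus_ge0 z.
  have fin (v s : R[i]) : modulus v = V m -> modulus (z * v + s * w) <= 14 * tau * V m ->
      modulus s = 1 -> False.
    move=> vm hv s1.
    have h1 : modulus (z * (z * v)) <= modulus z * (14 * tau * V m) + 28 * tau * V m.
      have -> : z * (z * v) = z * (z * v + s * w) - s * (z * w) by ring.
      apply: le_trans (modulusB _ _) _; rewrite (modulusM s) s1 mul1r (modulusM z (_ + _)).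
      by apply: lerD => //; apply: ler_wpM2l.
    rewrite !modulusM vm in h1.
    have h2 : modulus z * modulus z <= modulus z * (14 * tau) + 28 * tau.
      by rewrite -(ler_pM2r V0); lra.
    have h3 : r * modulus z <= modulus z * modulus z by apply: ler_wpM2r.
    have h4 : r ^+ 2 <= r * modulus z by rewrite expr2 ler_wpM2l // ltW.
    have h5 : r ^+ 2 <= r by rewrite expr2 ler_piMl // ltW.
    have h6 : modulus z * (14 * tau) <= modulus z * (4^-1 * r).
      by apply: ler_wpM2l => //; lra.
    lra.
  case: hm => hm.
    by apply: (fin _ (- 'i%C) hm); rewrite ?mulNr // modulusN modulusi.
  exact: (fin _ 'i%C hm hy (modulusi R)).
have [mx|mx] : modulus (x m) = V m \/ modulus (y m) = V m.
  have -> : V m = Num.max (modulus (x m)) (modulus (y m)) by [].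
  by case: leP => _; [right|left].
- case em : (m : nat) (ltn_ord m) => [|k] kn; first by case: headcase; left; rewrite -em.
  by left; apply: (tail z x y k) => //; rewrite -em.
- case em : (m : nat) (ltn_ord m) => [|k] kn; first by case: headcase; right; rewrite -em.
  right; rewrite -addJi; apply: (tail _ _ _ k eigJ) => //.
  + by move=> j; rewrite modulusJ.
  + by move=> j; rewrite modulusJ.
  + by rewrite modulusJ -em.
Qed.

(** By [mode_profile] the charge is positive and, at the damped site, dominated
    by [x].  Gain and loss in [charge_balance] then compare as
    [beta |x 0|^2] with [gamma |x n|^2], where [beta] carries the factor
    [(4 |eps|)^(2n)] and [|x n|] is only of order [|eps|^(n-1)] below the
    largest entry. *)
Lemma resonant_Re_lt0 z x y :
  16 ^+ n * tau <= 200^-1 -> eps != 0 -> modulus (z + 'i%C) <= 13 * tau ->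
  chain_eigen n eps gamma omega beta u z x y ->
  (exists2 k, (k <= n)%N & 0 < modulus (x k) + modulus (y k)) ->
  complex.Re z < 0.
Proof.
move=> tau16 eps0 zi eig nz; have ts := tau_small.
have tp := tau_ge0 near; have t1 := nss_eps near.
have t0 : 0 < `|eps| by rewrite normr_gt0.
have eigJ := chain_eigen_conj eig.
have [xn yn] := eig.1 _ (ltnSn n).
have ye k : (k < n)%N -> modulus (y k.+1) <=
    `|eps| * (modulus (y k) + modulus (y k.+2)) + modulus (u k.+1) ^+ 2 * modulus (x k.+1).
  move=> kn; have h := mode_tail eigJ kn; rewrite !modulusJ in h.
  set L := modulus _ in h.
  have hL : (2 - 13 * tau) * modulus (y k.+1) <= L + `|eps| * modulus (y k).
    have h1 : modulus ((conjc z + 'i%C) * conjc (y k.+1)) <= L + `|eps| * modulus (y k).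
      have := modulusB ((conjc z + 'i%C) * conjc (y k.+1) + 'i%C * eps%:C%C * conjc (y k))
        ('i%C * eps%:C%C * conjc (y k)).
      by rewrite addrK (modulusM ('i%C * _)) (modulusM 'i%C) modulusi mul1r modulus_real modulusJ.
    apply: le_trans h1; rewrite modulusM modulusJ addJi.
    apply: ler_wpM2r; first exact: modulus_ge0.
    have : modulus (2%:R * 'i%C) <= modulus (z + 'i%C) + modulus (z - 'i%C).
      have -> : 2%:R * 'i%C = (z + 'i%C) - (z - 'i%C) :> R[i] by ring.
      exact: modulusB.
    by rewrite modulusM modulus_nat modulusi; lra.
  have h2 : tau * modulus (y k.+1) <= 200^-1 * modulus (y k.+1).
    by apply: ler_wpM2r; rewrite ?modulus_ge0.
  have := modulus_ge0 (y k.+1); lra.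
have xe k : (k < n)%N -> `|eps| * modulus (x k) <=
    `|eps| * modulus (x k.+2) + 23 * tau * modulus (x k.+1)
    + modulus (u k.+1) ^+ 2 * modulus (y k.+1).
  move=> kn; have h := mode_tail eig kn.
  have h1 : `|eps| * modulus (x k) <=
      modulus ((z + 'i%C) * x k.+1 + 'i%C * eps%:C%C * x k)
      + modulus (z + 'i%C) * modulus (x k.+1).
    have := modulusB ((z + 'i%C) * x k.+1 + 'i%C * eps%:C%C * x k) ((z + 'i%C) * x k.+1).
    rewrite (addrC (_ * x k.+1)) addrK (modulusM ('i%C * _)) (modulusM 'i%C).
    by rewrite modulusi mul1r modulus_real (modulusM (z + _)).
  have h2 : modulus (z + 'i%C) * modulus (x k.+1) <= 13 * tau * modulus (x k.+1).
    by apply: ler_wpM2r; rewrite ?modulus_ge0.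
  lra.
have he : modulus (x 0%N) + modulus (y 0%N) <=
    6 * `|eps| * modulus (y 1%N) + 2 * `|eps| * modulus (x 1%N).
  have hx := mode_head eig; have hy := mode_head eigJ; rewrite !modulusJ in hy.
  set a0 := modulus (x 0%N) in hx hy *; set b0 := modulus (y 0%N) in hx hy *.
  have a00 : 0 <= a0 by exact: modulus_ge0.
  have b00 : 0 <= b0 by exact: modulus_ge0.
  have wa : modulus (z + 'i%C) * a0 <= 13 * tau * a0 by apply: ler_wpM2r.
  have wb : modulus (z + 'i%C) * b0 <= 13 * tau * b0 by apply: ler_wpM2r.
  have hA : a0 <= modulus (conjc z * conjc (y 0%N) - 'i%C * (conjc (y 0%N) + conjc (x 0%N)))
      + modulus (z + 'i%C) * b0.
    have h1 := modulusB (conjc (conjc z * conjc (y 0%N)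
        - 'i%C * (conjc (y 0%N) + conjc (x 0%N)))) ((z + 'i%C) * y 0%N).
    rewrite modulusJ modulusM -/b0 in h1; apply: le_trans h1.
    have -> : conjc (conjc z * conjc (y 0%N) - 'i%C * (conjc (y 0%N) + conjc (x 0%N)))
        - (z + 'i%C) * y 0%N = 'i%C * x 0%N by rewrite !conjcE; ring.
    by rewrite modulusM modulusi mul1r.
  have hB : b0 <= 2 * a0 + modulus (z * x 0%N - 'i%C * (x 0%N + y 0%N))
      + modulus (z + 'i%C) * a0.
    have -> : b0 = modulus ((z + 'i%C) * x 0%N - 2%:R * 'i%C * x 0%N
        - (z * x 0%N - 'i%C * (x 0%N + y 0%N))).
      have mi w : modulus w = modulus ('i%C * w) :> R by rewrite modulusM modulusi mul1r.
      rewrite /b0 -modulusN [RHS]mi; congr modulus.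
      have i2 := sqr_i R; rewrite expr2 in i2; ring: i2.
    apply: le_trans (modulusB _ _) _.
    have := modulusB ((z + 'i%C) * x 0%N) (2%:R * 'i%C * x 0%N).
    rewrite (modulusM (z + _)) (modulusM (2%:R * _)) (modulusM 2%:R) modulus_nat modulusi.
    by rewrite -/a0; lra.
  have ta : tau * a0 <= 200^-1 * a0 by apply: ler_wpM2r.
  have tb : tau * b0 <= 200^-1 * b0 by apply: ler_wpM2r.
  lra.
have [an_gt0 bn_le head_le charge_gt0] :=
  mode_profile n_gt0 t0 t1 tau16 (fun k => modulus_ge0 (x k)) (fun k => modulus_ge0 (y k))
    (fun k => exprn_ge0 2 (modulus_ge0 (u k)))
    (etrans (congr1 _ xn) (modulus0 R)) (etrans (congr1 _ yn) (modulus0 R))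
    (fun k kn => amplitude_sq_le n_gt0 tau_small near stat kn) ye xe he nz.
have bal := charge_balance n_gt0 eig.
rewrite -(pmulr_llt0 _ charge_gt0) bal.
have g0 := nss_gamma0 near.
have b0 := beta_ge0 n_gt0 tau_small near stat.
have bg := beta_le_gamma n_gt0 tau_small near stat.
have h1 : beta * modulus (x 0%N) ^+ 2 <= gamma * (modulus (x n) ^+ 2 / 4).
  apply: le_trans (_ : gamma * ((4 * `|eps|) ^+ n * modulus (x 0%N)) ^+ 2 <= _).
    by rewrite [X in _ <= gamma * X]exprMn [leRHS]mulrA; apply: ler_wpM2r => //; rewrite exprn_ge0 ?modulus_ge0.
  by apply: ler_wpM2l => //; exact: ltW.
have h2 : modulus (y n) ^+ 2 <= modulus (x n) ^+ 2 / 4.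
  have -> : modulus (x n) ^+ 2 / 4 = (modulus (x n) / 2) ^+ 2.
    by rewrite exprMn exprVn; congr (_ / _); ring.
  by apply: lerXn2r; rewrite ?nnegrE ?modulus_ge0 // divr_ge0 ?modulus_ge0.
have h3 : gamma * modulus (y n) ^+ 2 <= gamma * (modulus (x n) ^+ 2 / 4).
  by apply: ler_wpM2l => //; exact: ltW.
have h4 : 0 <= beta * modulus (y 0%N) ^+ 2.
  by rewrite mulr_ge0 ?exprn_ge0 ?modulus_ge0.
have h5 : 0 < gamma * modulus (x n) ^+ 2 by rewrite mulr_gt0 // exprn_gt0.
lra.
Qed.

(** The eigenvalues near [i] are conjugate to eigenvalues near [-i], with the
    roles of [x] and [y] exchanged. *)
Lemma eigenvalue_Re_lt0 z x y r :
  16 ^+ n * tau <= 200^-1 -> eps != 0 ->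
  0 < r -> r <= 1 -> 56 * tau < r ^+ 2 -> r <= modulus z ->
  chain_eigen n eps gamma omega beta u z x y ->
  (exists2 k, (k <= n)%N & 0 < modulus (x k) + modulus (y k)) ->
  complex.Re z < 0.
Proof.
move=> tau16 eps0 r0 r1 tr rz eig nz.
have [zi|zi] := eigenvalue_location r0 r1 tr rz eig nz.
  exact: resonant_Re_lt0 tau16 eps0 zi eig nz.
have -> : complex.Re z = complex.Re (conjc z) by case: z {rz eig nz zi}.
apply: resonant_Re_lt0 tau16 eps0 _ (chain_eigen_conj eig) _; first by rewrite addJi.
by case: nz => k kn h; exists k => //; rewrite !modulusJ addrC.
Qed.

End Modes.

(** * Dependence of the driving strength on the frequency *)

Section DrivingSlope.
Variable R : rcfType.
(* w and b are the derivatives of u and beta in omega; w_lin is the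
   differentiated stationarity equation *)
Variables (n : nat) (tau eps gamma omega beta b : R) (u w : nat -> R[i]).
Hypothesis n_gt0 : (0 < n)%N.
Hypothesis tau_small : tau <= 200^-1.
Hypothesis near : near_single_site tau eps gamma omega u.
Hypothesis stat : chain_stationary n eps gamma omega beta u.
Hypothesis eps_neq0 : eps != 0.
Hypothesis w_out : forall k, (n < k)%N -> w k = 0.
Hypothesis w_lin : forall k, (k <= n)%N ->
  chain_lin n eps gamma omega beta u w (fun j => conjc (w j)) k =
  'i%C * u k - (b * (k == 0%N)%:R)%:C%C * u k.
Hypothesis w_tail : forall k, (0 < k)%N -> modulus (w k) <= tau.

(* the diagonal coefficient of the stationarity equation, equal to 1 at the base
   point *)
Let kap (k : nat) : R[i] := 1 - ((detuning n eps omega k)%:C%C + u k * conjc (u k)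
    + (- 'i%C) * (forcing n beta gamma k)%:C%C).

Lemma site_balance k : (k < n)%N ->
  kap k.+1 * u k.+1 = - eps%:C%C * (u k + u k.+2).
Proof.
move=> kn; have [_ eqs] := stat; have e := eqs _ kn.
apply/eqP; rewrite -subr_eq0; apply/eqP.
transitivity ('i%C * chain_field n eps gamma omega beta u k.+1); last first.
  by rewrite e mulr0.
rewrite /chain_field /kap /lapf detuningE.
have i2 := sqr_i R; rewrite expr2 in i2; ring: i2.
Qed.

Lemma site_balance_slope k : (k < n)%N ->
  kap k.+1 * w k.+1
    + (1 - (conjc (u k.+1) * w k.+1 + u k.+1 * conjc (w k.+1))) * u k.+1
  = - eps%:C%C * (w k + w k.+2).
Proof.
move=> kn; have := w_lin kn; rewrite /= mulr0 rmorph0 mul0r subr0 => e.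
apply/eqP; rewrite -subr_eq0; apply/eqP.
transitivity ('i%C * (chain_lin n eps gamma omega beta u w (fun j => conjc (w j)) k.+1
   - 'i%C * u k.+1)); last by rewrite e subrr mulr0.
rewrite /chain_lin /kap /lapf detuningE.
have i2 := sqr_i R; rewrite expr2 in i2; ring: i2.
Qed.

(** Two consecutive zeros propagate towards the driven site, and a single zero is
    followed by another one because of [amplitude_decay]. *)
Lemma amplitude_neq0 k : (k <= n)%N -> u k != 0.
Proof.
have ts := tau_small; have tp := tau_ge0 near.
elim: k => [_|k IH kn].
  apply/eqP => u0; have := head_ge tau_small near; rewrite u0 modulus0; lra.
apply: contraNneq (IH (ltnW kn)) => uk; apply/eqP.
have uk2 : u k.+2 = 0.
  have [out _] := stat; have [h|h] := ltnP k.+1 n; last by apply: out; lia.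
  have := amplitude_decay n_gt0 tau_small near stat h; rewrite uk modulus0 mulr0 => h2.
  by apply: modulus_eq0; apply/eqP; rewrite eq_le h2 modulus_ge0.
have := site_balance kn; rewrite uk uk2 mulr0 addr0 => /esym/eqP.
by rewrite mulf_eq0 oppr_eq0 (inj_eq (@complexI R) eps 0) (negbTE eps_neq0) => /eqP.
Qed.

(* the logarithmic derivative of the amplitude *)
Let l (k : nat) := w k / u k.

Lemma kap_near1 k : (0 < k)%N -> modulus (kap k - 1) <= 7 * tau.
Proof.
move=> k0; rewrite /kap addrAC subrr sub0r modulusN.
apply: le_trans (modulusD _ _) _.
have := modulusD ((detuning n eps omega k)%:C%C) (u k * conjc (u k)).
rewrite modulus_real !modulusM modulusJ modulusN modulusi mul1r modulus_real -expr2.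
have := detuning_le n near k; have := forcing_le n_gt0 tau_small near stat k.
have := modulus_tail_sq tau_small near k0; lra.
Qed.

Let q k := - eps%:C%C * u k.+2 / u k.+1.

(** Eliminating [u k] between the equation and its derivative leaves a relation
    between increments of [l] on two neighbouring bonds, in which the far one
    carries the factor [q k] of order [eps^2]. *)
Lemma log_slope_rel k : (k < n)%N ->
  (kap k.+1 - q k) * (l k.+1 - l k + 1) =
  (kap k.+1 - 1) - q k
  + (conjc (u k.+1) * w k.+1 + u k.+1 * conjc (w k.+1))
  + q k * (l k.+2 - l k.+1).
Proof.
move=> kn; have e1 := site_balance kn; have e2 := site_balance_slope kn.
have u1 : u k.+1 != 0 by apply: amplitude_neq0.
have u0 : u k != 0 by apply: amplitude_neq0; exact: ltnW.
have w0E : w k = l k * u k by rewrite /l divfK.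
have w1E : w k.+1 = l k.+1 * u k.+1 by rewrite /l divfK.
have w2E : w k.+2 = l k.+2 * u k.+2.
  have [h|h] := ltnP k.+1 n; first by rewrite /l divfK // amplitude_neq0.
  by rewrite w_out ?(stat.1 k.+2) ?mulr0 //; lia.
have qE : q k * u k.+1 = - eps%:C%C * u k.+2 by rewrite /q divfK.
set s := _ + u k.+1 * conjc _ in e2 *.
apply: (mulIf u1).
have e3 : kap k.+1 * l k.+1 * u k.+1 + (1 - s) * u k.+1
    = - eps%:C%C * (l k * u k) + l k.+2 * (q k * u k.+1).
  by rewrite qE -mulrA -w1E e2 w0E w2E; ring.
have e4 : - eps%:C%C * u k = kap k.+1 * u k.+1 - q k * u k.+1.
  by rewrite e1 qE; ring.
have e5 : kap k.+1 * l k.+1 * u k.+1 + (1 - s) * u k.+1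
    = l k * (kap k.+1 * u k.+1 - q k * u k.+1) + l k.+2 * (q k * u k.+1).
  by rewrite e3 -e4; ring.
apply/eqP; rewrite -subr_eq0; apply/eqP.
transitivity (kap k.+1 * l k.+1 * u k.+1 + (1 - s) * u k.+1
  - (l k * (kap k.+1 * u k.+1 - q k * u k.+1) + l k.+2 * (q k * u k.+1))).
  ring.
by rewrite e5 subrr.
Qed.

(** [u k.+1 / u k] is close to [- eps / omega], whose logarithmic derivative at
    [omega = 1] is -1.  The increments are controlled one after the other,
    starting from the damped end. *)
Lemma log_slope_step k : (k < n)%N -> modulus (l k.+1 - l k + 1) <= 2^-1.
Proof.
have ts := tau_small; have tp := tau_ge0 near.
have step j : (j < n)%N -> modulus (q j) <= tau ->
    modulus (q j * (l j.+2 - l j.+1)) <= 2 * tau ->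
    modulus (l j.+1 - l j + 1) <= 2^-1.
  move=> jn hq hqr; have rel := log_slope_rel jn.
  have hk := kap_near1 (ltn0Sn j).
  set s := _ + u j.+1 * conjc _ in rel.
  have hs : modulus s <= tau.
    apply: le_trans (modulusD _ _) _; rewrite !modulusM !modulusJ.
    have h1 := nss_tail near (ltn0Sn j); have h2 := w_tail (ltn0Sn j).
    have : modulus (u j.+1) * modulus (w j.+1) <= 4^-1 * tau.
      by apply: ler_pM; rewrite ?modulus_ge0 //; lra.
    lra.
  have hd : 2^-1 <= modulus (kap j.+1 - q j).
    have := modulusB (kap j.+1 - q j) ((kap j.+1 - 1) - q j).
    have -> : kap j.+1 - q j - (kap j.+1 - 1 - q j) = 1 by ring.
    by rewrite (modulus_nat R 1); have := modulusB (kap j.+1 - 1) (q j); lra.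
  have hX : modulus (kap j.+1 - q j) * modulus (l j.+1 - l j + 1) <= 11 * tau.
    rewrite -modulusM rel.
    have := modulusD ((kap j.+1 - 1) - q j + s) (q j * (l j.+2 - l j.+1)).
    have := modulusD ((kap j.+1 - 1) - q j) s; have := modulusB (kap j.+1 - 1) (q j).
    lra.
  have X0 := modulus_ge0 (l j.+1 - l j + 1).
  have : 2^-1 * modulus (l j.+1 - l j + 1)
      <= modulus (kap j.+1 - q j) * modulus (l j.+1 - l j + 1) by apply: ler_wpM2r.
  lra.
have q_far j : (j.+1 = n)%N -> q j = 0.
  by move=> jn; rewrite /q (stat.1 j.+2) ?mulr0 ?mul0r // -jn.
have hq j : (j < n)%N -> modulus (q j) <= tau.
  rewrite leq_eqVlt => /predU1P[/q_far ->|jn]; first by rewrite modulus0.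
  have d := amplitude_decay n_gt0 tau_small near stat jn; have t1 := nss_eps near.
  have u1 : 0 < modulus (u j.+1) by apply/modulus_gt0/amplitude_neq0/ltnW.
  rewrite /q modulusM modulusV ler_pdivrMr //.
  rewrite modulusM modulusN modulus_real.
  apply: (@le_trans _ _ (`|eps| * (4 * `|eps| * modulus (u j.+1)))).
    by apply: ler_wpM2l.
  rewrite !mulrA; apply: ler_wpM2r; first exact: modulus_ge0.
  have : `|eps| * `|eps| <= 200^-1 * tau by apply: ler_pM => //; lra.
  lra.
suff st m : forall k, (k + m).+1 = n -> modulus (l k.+1 - l k + 1) <= 2^-1.
  by move=> kn; apply: (st (n - k.+1)%N); move: kn; clear; lia.
elim: m => [|m IH] j jm.
  apply: step; [by move: jm; clear; lia | apply: hq; move: jm; clear; lia |].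
  by rewrite q_far ?mul0r ?modulus0; [lra | move: jm; clear; lia].
have jn : (j.+1 < n)%N by move: jm; clear; lia.
apply: step; [exact: ltnW | exact: hq (ltnW jn) |].
rewrite modulusM mulrC; apply: ler_pM; rewrite ?modulus_ge0 ?(hq j (ltnW jn)) //.
have h := IH j.+1 ltac:(move: jm; clear; lia).
have -> : l j.+2 - l j.+1 = (l j.+2 - l j.+1 + 1) - 1 by ring.
by apply: le_trans (modulusB _ _) _; rewrite (modulus_nat R 1); lra.
Qed.

Lemma log_slope_drop k : (k <= n)%N ->
  complex.Re (l k) <= complex.Re (l 0%N) - k%:R / 2.
Proof.
elim: k => [|k IH] kn; first by rewrite mul0r subr0.
have h1 := IH (ltnW kn); have h2 := log_slope_step kn.
have h3 := Re_le_modulus (l k.+1 - l k + 1).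
have : complex.Re (l k.+1 - l k + 1) = complex.Re (l k.+1) - complex.Re (l k) + 1.
  by rewrite !raddfD raddfN.
move: (ler_norm (complex.Re (l k.+1 - l k + 1))).
rewrite -natr1; lra.
Qed.

Lemma Re_conjM_log k : (k <= n)%N ->
  complex.Re (conjc (u k) * w k) = modulus (u k) ^+ 2 * complex.Re (l k).
Proof.
move=> kn; have -> : w k = u k * l k by rewrite /l mulrC divfK // amplitude_neq0.
rewrite mulrA (mulrC (conjc _)) mul_conjc.
by case: (l k) => a c /=; rewrite mul0r subr0.
Qed.

(* the derivative of the power balance in omega *)
Hypothesis b_balance :
  b * modulus (u 0%N) ^+ 2 + 2 * beta * complex.Re (conjc (u 0%N) * w 0%N)
  = 2 * gamma * complex.Re (conjc (u n) * w n).

(** In logarithmic derivatives the differentiated balance reads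
    [b |u_0|^2 = 2 gamma |u_n|^2 Re (l_n - l_0)]. *)
Lemma driving_slope_lt0 : b < 0.
Proof.
have ts := tau_small; have tp := tau_ge0 near.
have bal := beta_head n_gt0 stat.
have bb := b_balance; rewrite !Re_conjM_log // in bb.
have h1 := head_ge tau_small near.
have u0 : 0 < modulus (u 0%N) ^+ 2 by apply: exprn_gt0; lra.
rewrite -(pmulr_llt0 _ u0).
have un : 0 < gamma * modulus (u n) ^+ 2.
  rewrite mulr_gt0 ?exprn_gt0 ?modulus_gt0 ?amplitude_neq0 //.
  exact: nss_gamma0 near.
have d := log_slope_drop (leqnn n).
have n2 : 0 < n%:R / 2 :> R by rewrite divr_gt0 ?ltr0n.
have -> : b * modulus (u 0%N) ^+ 2 = 2 * (gamma * modulus (u n) ^+ 2)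
    * (complex.Re (l n) - complex.Re (l 0%N)).
  have e : 2 * beta * (modulus (u 0%N) ^+ 2 * complex.Re (l 0%N))
    = 2 * (gamma * modulus (u n) ^+ 2) * complex.Re (l 0%N) by rewrite -bal; ring.
  by rewrite e in bb; lra.
have u2 : 0 < 2 * (gamma * modulus (u n) ^+ 2) by rewrite mulr_gt0.
rewrite (pmulr_rlt0 _ u2) subr_lt0; apply: le_lt_trans d _.
by rewrite ltrBlDr ltrDl.
Qed.

Lemma driving_slope_le : modulus (w 0%N) <= 1 -> `|b| <= 10 * gamma.
Proof.
move=> w0; have ts := tau_small; have tp := tau_ge0 near.
have g0 := nss_gamma0 near.
have h1 := head_ge tau_small near; have h2 := head_le near.
have bg := beta_le_gamma n_gt0 tau_small near stat.
have b0 := beta_ge0 n_gt0 tau_small near stat.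
have t1 := nss_eps near.
have bg' : beta <= gamma.
  apply: le_trans bg _; rewrite ler_piMr ?(ltW g0) // !exprn_ile1 ?exprn_ge0 ?mulr_ge0 //.
  lra.
have hn : `|complex.Re (conjc (u n) * w n)| <= 1.
  apply: le_trans (Re_le_modulus _) _; rewrite modulusM modulusJ.
  have := nss_tail near n_gt0; have := w_tail n_gt0.
  move=> c1 c2; rewrite -[leRHS]mulr1; apply: ler_pM; rewrite ?modulus_ge0 //; lra.
have h0 : `|complex.Re (conjc (u 0%N) * w 0%N)| <= 2.
  apply: le_trans (Re_le_modulus _) _; rewrite modulusM modulusJ.
  by rewrite -[leRHS]mulr1; apply: ler_pM; rewrite ?modulus_ge0 //; lra.
have e : b * modulus (u 0%N) ^+ 2 = 2 * gamma * complex.Re (conjc (u n) * w n)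
   - 2 * beta * complex.Re (conjc (u 0%N) * w 0%N) by rewrite -b_balance addrK.
have hb : `|b| * modulus (u 0%N) ^+ 2 <= 6 * gamma.
  have -> : `|b| * modulus (u 0%N) ^+ 2 = `|b * modulus (u 0%N) ^+ 2|.
    by rewrite normrM (ger0_norm (exprn_ge0 2 (modulus_ge0 _))).
  rewrite e; apply: le_trans (ler_normB _ _) _; rewrite !normrM.
  rewrite (ger0_norm b0) (gtr0_norm g0) (ger0_norm (ler0n R 2)).
  have : gamma * `|complex.Re (conjc (u n) * w n)| <= gamma * 1.
    by apply: ler_wpM2l => //; exact: ltW.
  have : beta * `|complex.Re (conjc (u 0%N) * w 0%N)| <= gamma * 2.
    by apply: ler_pM.
  lra.
have m2 : (199 / 200) * (199 / 200) <= modulus (u 0%N) ^+ 2.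
  by rewrite expr2; apply: ler_pM; lra.
have : `|b| * ((199 / 200) * (199 / 200)) <= `|b| * modulus (u 0%N) ^+ 2.
  by apply: ler_wpM2l.
lra.
Qed.

End DrivingSlope.

(** * The characteristic polynomial *)

Section Bordered.
Variables (K : comNzRingType) (m : nat).
Implicit Types (J : 'M[K]_m) (v : 'rV[K]_m).

(** The determinant of the characteristic matrix with its row [k]
    replaced by [v]; the form through the adjugate is linear in [v] by
    construction. *)
Definition adj_coord J v (k : 'I_m) : {poly K} :=
  (map_mx polyC v *m \adj (char_poly_mx J)) 0 k.

Lemma adj_coordD J v1 v2 k : adj_coord J (v1 + v2) k = adj_coord J v1 k + adj_coord J v2 k.
Proof. by rewrite /adj_coord map_mxD mulmxDl mxE. Qed.

Lemma adj_coordZ J a v k : adj_coord J (a *: v) k = a%:P * adj_coord J v k.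
Proof. by rewrite /adj_coord map_mxZ -scalemxAl mxE. Qed.

(** Cramer's rule. *)
Lemma adj_coord_mul J v k :
  adj_coord J (v *m J) k = 'X * adj_coord J v k - (v 0 k)%:P * char_poly J.
Proof.
have -> : adj_coord J (v *m J) k
    = (('X *: map_mx polyC v - map_mx polyC v *m char_poly_mx J)
       *m \adj (char_poly_mx J)) 0 k.
  by rewrite /char_poly_mx mulmxBr mul_mx_scalar opprB addrC subrK -map_mxM.
rewrite mulmxBl -scalemxAl -mulmxA mul_mx_adj mul_mx_scalar.
have subE (a c : 'rV[{poly K}]_m) : (a - c) 0 k = a 0 k - c 0 k by rewrite !mxE.
have scaleE p (a : 'rV[{poly K}]_m) : (p *: a) 0 k = p * a 0 k by rewrite mxE.
rewrite subE !scaleE; have -> : map_mx polyC v 0 k = (v 0 k)%:P by rewrite mxE.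
by rewrite (mulrC (\det _)).
Qed.

(** Applying [adj_coord] to the two relations expresses the characteristic
    polynomial through [h] and [e].  For [b = 0] the root 0 is double, with
    Jordan chain [h], [g]; the defect [b *: e] moves one of the two copies. *)
Lemma char_poly_split J (g h e : 'rV[K]_m) (b : K) k :
  g *m J = 0 -> h *m J = g - b *: e -> h 0 k = 0 ->
  (g 0 k)%:P * char_poly J =
  'X * ('X * adj_coord J h k + b%:P * adj_coord J e k).
Proof.
move=> gJ hJ hk.
have hg := adj_coord_mul J g k; have hh := adj_coord_mul J h k.
rewrite gJ -(scale0r 0) adj_coordZ mul0r in hg.
rewrite hJ hk mul0r subr0 -scaleNr adj_coordD adj_coordZ polyCN in hh.
have -> : 'X * adj_coord J h k + b%:P * adj_coord J e k = adj_coord J g k.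
  by rewrite -hh; ring.
by apply/eqP; rewrite -subr_eq0 -oppr_eq0 opprB -hg.
Qed.

End Bordered.

Lemma char_poly_trmx (K : comNzRingType) m (J : 'M[K]_m) : char_poly J^T = char_poly J.
Proof.
rewrite /char_poly -[RHS]det_tr; congr (\det _).
by apply/matrixP => i j; rewrite !mxE eq_sym.
Qed.

(** * The uncoupled chain *)

Section Uncoupled.
Variables (K : fieldType) (m : nat).

(** Multiplying the characteristic matrix by a block triangular one makes it
    block triangular; the extra factor [X^m] is cancelled afterwards. *)
Lemma char_poly_offdiag (c d : 'rV[K]_m) :
  char_poly (block_mx 0 (diag_mx c) (diag_mx d) 0) =
  \prod_(j < m) ('X^2 - (c 0 j * d 0 j)%:P).
Proof.
have nz : 'X^m != 0 :> {poly K} by rewrite monic_neq0 ?monicXn.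
apply: (mulIf nz).
have dM : char_poly_mx (block_mx 0 (diag_mx c) (diag_mx d) 0)
    *m block_mx 'X%:M 0 (map_mx polyC (diag_mx d)) 1%:M
  = block_mx (diag_mx (\row_j ('X^2 - (c 0 j * d 0 j)%:P)))
      (- map_mx polyC (diag_mx c)) 0 'X%:M.
  rewrite /char_poly_mx map_block_mx !map_mx0 scalar_mx_block opp_block_mx add_block_mx.
  rewrite !subr0 !sub0r ?oppr0 ?addr0 mulmx_block !mulmx0 !add0r !mulmx1.
  congr block_mx.
    apply/matrixP => i j; rewrite mulNmx !map_diag_mx mulmx_diag -scalar_mxM !mxE.
    by case: eqP => _; rewrite ?mulr1n ?mulr0n ?subr0 // expr2 polyCM.
  by rewrite mulNmx mul_mx_scalar mul_scalar_mx addNr.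
move/(congr1 determinant): dM.
rewrite det_mulmx det_lblock det_ublock det_diag det1 mulr1 !det_scalar.
by under eq_bigr do rewrite mxE.
Qed.

End Uncoupled.

Section UncoupledHead.
Variables (K : fieldType) (n : nat).

(** The linearization at the base point, acting on row vectors: the driven site
    carries a nilpotent block and every other site a rotation. *)
Definition uncoupled_mx : 'M[K]_(n.+1 + n.+1) :=
  block_mx 0 (diag_mx (\row_j (if j == 0 then 2 else -1)))
             (diag_mx (\row_j (if j == 0 then 0 else 1))) 0.

Definition head_p : 'rV[K]_(n.+1 + n.+1) := row_mx (delta_mx 0 0) 0.
Definition head_q : 'rV[K]_(n.+1 + n.+1) := row_mx 0 (delta_mx 0 0).
Definition head_q_index : 'I_(n.+1 + n.+1) := rshift n.+1 ord0.

(** [head_p] and [2 *: head_q] form a Jordan chain for the eigenvalue 0, so two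
    applications of [adj_coord_mul] reduce the claim to the characteristic
    polynomial. *)
Lemma adj_coord_uncoupled :
  adj_coord uncoupled_mx head_p head_q_index = 2%:P * ('X^2 + 1) ^+ n.
Proof.
have eJ : head_p *m uncoupled_mx = 2 *: head_q.
  rewrite /head_p /head_q /uncoupled_mx mul_row_block !mulmx0 !mul0mx !addr0.
  rewrite scale_row_mx scaler0; congr row_mx; apply/rowP => j.
  by rewrite mul_mx_diag !mxE !eqxx /=; case: (eqVneq j 0) => _; rewrite ?mulr1n ?mulr0n ?mul1r ?mul0r ?mulr1 ?mulr0.
have qJ : head_q *m uncoupled_mx = 0 *: head_q.
  rewrite /head_q /uncoupled_mx mul_row_block !mulmx0 !mul0mx !add0r scale0r.
  rewrite -[RHS]row_mx0; congr row_mx; apply/rowP => j.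
  by rewrite mul_mx_diag !mxE !eqxx /=; case: (eqVneq j 0) => _; rewrite ?mulr1n ?mulr0n ?mul1r ?mul0r ?mulr1 ?mulr0.
have h1 := adj_coord_mul uncoupled_mx head_p head_q_index.
have h2 := adj_coord_mul uncoupled_mx head_q head_q_index.
have pk : head_p 0 head_q_index = 0 by rewrite /head_p row_mxEr mxE.
have qk : head_q 0 head_q_index = 1 by rewrite /head_q row_mxEr mxE !eqxx.
rewrite eJ adj_coordZ pk mul0r subr0 in h1.
rewrite qJ adj_coordZ qk !mul1r mul0r in h2.
have chi : char_poly uncoupled_mx = 'X^2 * ('X^2 + 1) ^+ n.
  rewrite /uncoupled_mx char_poly_offdiag big_ord_recl !mxE /= mulr0 subr0; congr (_ * _).
  under eq_bigr do rewrite !mxE /= mulN1r polyCN opprK.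
  by rewrite prodr_const card_ord.
have nz : 'X^2 != 0 :> {poly K} by rewrite monic_neq0 ?monicXn.
apply: (mulfI nz).
have h3 : char_poly uncoupled_mx = 'X * adj_coord uncoupled_mx head_q head_q_index.
  by apply/eqP; rewrite -subr_eq0 -oppr_eq0 opprB -h2.
transitivity ('X * ('X * adj_coord uncoupled_mx head_p head_q_index)).
  by rewrite mulrA -expr2.
by rewrite -h1 mulrCA -h3 chi; ring.
Qed.

Lemma adj_coord_uncoupled0 :
  (adj_coord uncoupled_mx head_p head_q_index)`_0 = 2.
Proof.
rewrite adj_coord_uncoupled -horner_coef0 !hornerE.
by rewrite ?expr0n /= ?mulr0 ?add0r ?expr1n ?mulr1.
Qed.

End UncoupledHead.

(** * Roots of a polynomial near zero *)

Section SmallRoot.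

(** The quotient [(p(b) - p(a)) / (b - a)], expanded so that it makes sense for
    [a = b], and with a bound [m] on the size of [p] in place of the size, so
    that it commutes with ring morphisms. *)
Definition divided_difference (K : comNzRingType) (p : {poly K}) m (a b : K) : K :=
  \sum_(k < m) p`_k * (\sum_(i < k) b ^+ (k.-1 - i) * a ^+ i).

Lemma divided_differenceE (K : comNzRingType) (p : {poly K}) m (a b : K) :
  (size p <= m)%N -> p.[b] - p.[a] = (b - a) * divided_difference p m a b.
Proof.
move=> sp; rewrite !(horner_coef_wide _ sp) -sumrB mulr_sumr.
apply: eq_bigr => k _; rewrite -mulrBr mulrCA; congr (_ * _).
by rewrite subrXX; congr (_ * _); apply: eq_bigr.
Qed.

(** Every term except the one of the linear coefficient has a factor [a] or [b]. *)
Lemma divided_difference_near (K : numDomainType) (p : {poly K}) m (a b C r : K) :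
  0 <= C -> 0 <= r -> r <= 1 -> `|a| <= r -> `|b| <= r ->
  (forall k, `|p`_k| <= C) ->
  `|divided_difference p m.+2 a b - p`_1| <= m.+2%:R * (C * (m.+2%:R * r)).
Proof.
move=> C0 r0 r1 ar br pC.
rewrite /divided_difference !big_ord_recl big_ord0 /= mulr0 add0r.
rewrite big_ord0 !expr0 addr0 !mulr1 addrAC subrr add0r.
apply: le_trans (ler_norm_sum _ _ _) _.
apply: (@le_trans _ _ (\sum_(i < m) C * (m.+2%:R * r))).
  apply: ler_sum => i _; rewrite normrM; apply: ler_pM => //.
  apply: le_trans (ler_norm_sum _ _ _) _.
  apply: (@le_trans _ _ (\sum_(j < bump 0 (bump 0 i)) r)).
    apply: ler_sum => j _; rewrite normrM !normrX.
    have ja : `|a| ^+ j <= r ^+ j by apply: lerXn2r; rewrite ?nnegrE.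
    have jb : `|b| ^+ (i.+1 - j) <= r ^+ (i.+1 - j) by apply: lerXn2r; rewrite ?nnegrE.
    have -> : ((bump 0 (bump 0 i)).-1 - j = i.+1 - j)%N by [].
    apply: (@le_trans _ _ (r ^+ (i.+1 - j) * r ^+ j)).
      by apply: ler_pM; rewrite ?exprn_ge0.
    rewrite -exprD subnK; last by rewrite -ltnS; have := ltn_ord j; rewrite /bump /=.
    by rewrite exprS ler_piMr // exprn_ile1.
  rewrite sumr_const card_ord -[leLHS]mulr_natl; apply: ler_wpM2r => //.
  by rewrite ler_nat /bump /= !add1n; have := ltn_ord i; lia.
rewrite sumr_const card_ord -[leLHS]mulr_natl; apply: ler_wpM2r.
  by rewrite !mulr_ge0.
by rewrite ler_nat; lia.
Qed.

Variable R : rcfType.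

Local Notation toC := (real_complex R).

(** The positive root comes from the intermediate value theorem.  The values of
    the quotient [rho] are divided differences of [p] at [lambda] and [z], which
    near 0 are close to the linear coefficient and so do not vanish; this covers
    the possibility of a second root equal to [lambda]. *)
Lemma small_root (p : {poly R}) m (C r : R) :
  0 <= C -> 0 < r -> r <= 1 -> m.+2%:R * (C * (m.+2%:R * r)) <= 4^-1 ->
  (size p <= m.+2)%N -> (forall k, `|p`_k| <= C) -> 2^-1 <= p`_1 ->
  p`_0 < 0 -> 4 * `|p`_0| <= r ->
  exists lambda (rho : {poly R}), [/\ 0 < lambda, lambda <= 4 * `|p`_0|,
    p = rho * ('X - lambda%:P) &
    forall z, root (map_poly toC rho) z -> r <= modulus z].
Proof.
move=> C0 r0 r1 Cr sp pC p1 p0 p0r.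
set t := 4 * `|p`_0|.
have t0 : 0 < t by rewrite mulr_gt0 // normr_gt0 ltr0_neq0.
have pt : 0 <= p.[t].
  have e := divided_differenceE 0 t sp.
  have d : `|divided_difference p m.+2 0 t - p`_1| <= 4^-1.
    apply: le_trans Cr; apply: divided_difference_near; rewrite ?normr0 ?(ltW r0) //.
    by rewrite gtr0_norm.
  rewrite subr0 horner_coef0 in e; rewrite ler_norml in d; case/andP: d => d _.
  have : t * 4^-1 <= t * divided_difference p m.+2 0 t.
    by apply: ler_wpM2l; [exact: ltW | lra].
  have : t * 4^-1 = - p`_0 by rewrite /t ltr0_norm //; field.
  lra.
have p00 : p.[0] <= 0 <= p.[t] by rewrite pt andbT horner_coef0 ltW.
have [lambda /andP[l0 lt] rl] := poly_ivt (ltW t0) p00.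
have l_gt0 : 0 < lambda.
  rewrite lt_def l0 andbT; apply: contraTneq p0 => l00.
  by move: rl; rewrite l00 /root horner_coef0 => /eqP ->; rewrite ltxx.
have /factor_theorem[rho prho] := rl.
exists lambda, rho; split=> // z rz; rewrite leNgt; apply/negP => zr.
have rhoE : rho = divided_difference (map_poly polyC p) m.+2 lambda%:P 'X.
  have nz : 'X - lambda%:P != 0 by rewrite polyXsubC_eq0.
  apply: (mulIf nz); rewrite -prho mulrC -divided_differenceE.
    by rewrite -/(p \Po 'X) -/(p \Po _) comp_polyXr comp_polyCr (eqP rl) subr0.
  by rewrite size_map_polyC.
have rzE : (map_poly toC rho).[z] = divided_difference (map_poly toC p) m.+2 (toC lambda) z.
  rewrite rhoE /divided_difference rmorph_sum horner_sum; apply: eq_bigr => k _.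
  rewrite rmorphM hornerM coef_map /= coef_map /= map_polyC hornerC; congr (_ * _).
  rewrite rmorph_sum horner_sum; apply: eq_bigr => i _.
  by rewrite rmorphM hornerM !rmorphXn /= map_polyX map_polyC !horner_exp hornerX hornerC.
have normE (w : R[i]) : `|w| = toC (modulus w) by [].
have toC_le (x y : R) : (toC x <= toC y) = (x <= y) by rewrite lecR.
have aC : `|toC lambda| <= toC r.
  by rewrite normE modulus_real gtr0_norm // toC_le (le_trans lt).
have bC : `|z| <= toC r by rewrite normE toC_le ltW.
have cC k : `|(map_poly toC p)`_k| <= toC C.
  by rewrite coef_map /= normE modulus_real toC_le.
have C0' : 0 <= toC C by rewrite ler0c.
have r0' : 0 <= toC r by rewrite ler0c ltW.
have r1' : toC r <= 1 by rewrite -(rmorph1 toC) toC_le.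
have := divided_difference_near m C0' r0' r1' aC bC cC.
have p1E : (map_poly toC p)`_1 = toC p`_1 by rewrite coef_map.
rewrite -rzE (eqP rz) sub0r p1E normrN normE modulus_real.
rewrite -(rmorph_nat toC) -!rmorphM toC_le => h.
have := ler_norm p`_1; lra.
Qed.

End SmallRoot.

(** * The vector field and its Jacobian in complex coordinates *)

Section Derivatives.
Local Open Scope classical_set_scope.
Local Open Scope ring_scope.
Variables (R : realType) (V : normedModType R).

(** For the coordinate functions, whose difference quotients are constant, this
    avoids the differential of a linear map. *)
Lemma is_derive_affine (f : V -> R) x v c :
  (forall h : R, f (h *: v + x) = h * c + f x) -> is_derive x v f c.
Proof.
move=> fE.
have H : (fun h => h^-1 *: ((f \o shift x) (h *: v) - f x)) @ 0^' --> c.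
  apply: cvg_near_cst; near=> h.
  have h0 : h != 0 by near: h; exact: nbhs_dnbhs_neq.
  by rewrite /= fE addrK; apply: mulKf.
apply: DeriveDef; first by apply/cvg_ex; exists c.
exact: cvg_lim H.
Unshelve. all: by end_near. Qed.

Variable n : nat.

Definition field_p (eps gamma omega beta : R) (P Q : nat -> R) k : R :=
  eps * lapf n Q k + omega * Q k - (P k * P k + Q k * Q k) * Q k
  + forcing n beta gamma k * P k.

Definition field_q (eps gamma omega beta : R) (P Q : nat -> R) k : R :=
  - eps * lapf n P k - omega * P k + (P k * P k + Q k * Q k) * P k
  + forcing n beta gamma k * Q k.

Definition dfield_p (eps gamma omega beta : R) (P Q dP dQ : nat -> R) k : R :=
  eps * lapf n dQ k + omega * dQ k
  - (2 * P k * Q k * dP k + (P k * P k + 3 * (Q k * Q k)) * dQ k)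
  + forcing n beta gamma k * dP k.

Definition dfield_q (eps gamma omega beta : R) (P Q dP dQ : nat -> R) k : R :=
  - eps * lapf n dP k - omega * dP k
  + (2 * P k * Q k * dQ k + (3 * (P k * P k) + Q k * Q k) * dP k)
  + forcing n beta gamma k * dQ k.

Lemma is_derive_lapf (Q : nat -> V -> R) (dQ : nat -> R) x v k :
  (forall j, is_derive x v (Q j) (dQ j)) ->
  is_derive x v (fun y => lapf n (fun j => Q j y) k) (lapf n dQ k).
Proof.
by move=> hQ; rewrite /lapf; case: k => [|k] /=; apply: is_derive_eq.
Qed.

Variables (E G W B : V -> R) (P Q : nat -> V -> R).
Variables (x v : V) (dW dB : R) (dP dQ : nat -> R).
Hypotheses (hE : is_derive x v E 0) (hG : is_derive x v G 0).
Hypotheses (hW : is_derive x v W dW) (hB : is_derive x v B dB).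
Hypotheses (hP : forall j, is_derive x v (P j) (dP j)).
Hypotheses (hQ : forall j, is_derive x v (Q j) (dQ j)).

Lemma is_derive_field_p k :
  is_derive x v (fun y => field_p (E y) (G y) (W y) (B y) (P^~ y) (Q^~ y) k)
    (dfield_p (E x) (G x) (W x) (B x) (P^~ x) (Q^~ x) dP dQ k
     + dW * Q k x + dB * (k == 0%N)%:R * P k x).
Proof.
have hL := is_derive_lapf k hQ; have hPk := hP k; have hQk := hQ k.
rewrite /field_p /forcing; apply: is_derive_eq.
transitivity (E x * lapf n dQ k + lapf n (Q^~ x) k * 0 + (W x * dQ k + Q k x * dW) -
  ((P k x * P k x + Q k x * Q k x) * dQ k +
   Q k x * (P k x * dP k + P k x * dP k + (Q k x * dQ k + Q k x * dQ k))) +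
  ((B x * (k == 0%N)%:R - G x * (k == n)%:R) * dP k +
   P k x * (B x * 0 + (k == 0%N)%:R * dB - (G x * 0 + (k == n)%:R * 0)))); first by [].
by rewrite /dfield_p /forcing /=; ring.
Qed.

Lemma is_derive_field_q k :
  is_derive x v (fun y => field_q (E y) (G y) (W y) (B y) (P^~ y) (Q^~ y) k)
    (dfield_q (E x) (G x) (W x) (B x) (P^~ x) (Q^~ x) dP dQ k
     - dW * P k x + dB * (k == 0%N)%:R * Q k x).
Proof.
have hL := is_derive_lapf k hP; have hPk := hP k; have hQk := hQ k.
rewrite /field_q /forcing; apply: is_derive_eq.
transitivity (- E x * lapf n dP k + lapf n (P^~ x) k * - 0 - (W x * dP k + P k x * dW) +
  ((P k x * P k x + Q k x * Q k x) * dP k +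
   P k x * (P k x * dP k + P k x * dP k + (Q k x * dQ k + Q k x * dQ k))) +
  ((B x * (k == 0%N)%:R - G x * (k == n)%:R) * dQ k +
   Q k x * (B x * 0 + (k == 0%N)%:R * dB - (G x * 0 + (k == n)%:R * 0)))); first by [].
by rewrite /dfield_q /forcing /=; ring.
Qed.

End Derivatives.

Section Coordinates.
Variables (R : realType) (n : nat).
Local Notation N := n.+1.
Implicit Types (p q : 'rV[R]_N) (v w : 'rV[R]_(N + N)).

Lemma siteE p (j : 'I_N) : site p j = p 0 j.
Proof. by rewrite /site valK. Qed.

Lemma site_out p k : (n < k)%N -> site p k = 0.
Proof. by move=> nk; rewrite /site insubN // -leqNgt. Qed.

Lemma laplacianE p (j : 'I_N) : (0 < n)%N -> laplacian p 0 j = lapf n (site p) j.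
Proof.
move=> n0; rewrite mxE /lapf; have jn : (j <= n)%N by rewrite -ltnS.
rewrite !eqSS; case: (nat_of_ord j) jn => [|k] kn /=.
  have -> : (0%N != n) = true by rewrite eq_sym -lt0n.
  by rewrite /=; ring.
have [e|ne] := eqVneq k.+1 n; last by rewrite /=; ring.
have -> : n.-1 = k by rewrite -e.
have -> : site p n = site p k.+1 by congr site; rewrite e.
by rewrite (site_out p (k := k.+2)) ?e //=; ring.
Qed.

(** The complex coordinate [p_k + i q_k], extended by 0 beyond the last site. *)
Definition amplitude v k : R[i] := Complex (site (lsubmx v) k) (site (rsubmx v) k).

Lemma amplitude_out v k : (n < k)%N -> amplitude v k = 0.
Proof. by move=> nk; rewrite /amplitude !site_out. Qed.

Lemma amplitude_inj v w : (forall k, (k <= n)%N -> amplitude v k = amplitude w k) -> v = w.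
Proof.
move=> h; rewrite -(hsubmxK v) -(hsubmxK w).
by congr row_mx; apply/rowP => j; have [] := h j (ltn_ord j); rewrite !siteE.
Qed.

Lemma chain_fieldE eps gamma omega beta (P Q : nat -> R) k :
  chain_field n eps gamma omega beta (fun j => Complex (P j) (Q j)) k =
  Complex (field_p n eps gamma omega beta P Q k) (field_q n eps gamma omega beta P Q k).
Proof.
have lE : lapf n (fun j => Complex (P j) (Q j)) k = Complex (lapf n P k) (lapf n Q k).
  rewrite /lapf; have -> : ((k != 0%N) + (k != n))%:R
      = (((k != 0%N) + (k != n))%:R)%:C%C :> R[i] by rewrite rmorph_nat.
  by case: k => [|k]; apply/eqP; rewrite eq_complex /=; apply/andP; split; apply/eqP; ring.
rewrite /chain_field lE /field_p /field_q; move: (forcing _ _ _ _) => f.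
by apply/eqP; rewrite eq_complex /=; apply/andP; split; apply/eqP; ring.
Qed.

Lemma chain_linE eps gamma omega beta (P Q dP dQ : nat -> R) k :
  chain_lin n eps gamma omega beta (fun j => Complex (P j) (Q j))
    (fun j => Complex (dP j) (dQ j)) (fun j => conjc (Complex (dP j) (dQ j))) k =
  Complex (dfield_p n eps gamma omega beta P Q dP dQ k)
          (dfield_q n eps gamma omega beta P Q dP dQ k).
Proof.
have lE : lapf n (fun j => Complex (dP j) (dQ j)) k = Complex (lapf n dP k) (lapf n dQ k).
  rewrite /lapf; have -> : ((k != 0%N) + (k != n))%:R
      = (((k != 0%N) + (k != n))%:R)%:C%C :> R[i] by rewrite rmorph_nat.
  by case: k => [|k]; apply/eqP; rewrite eq_complex /=; apply/andP; split; apply/eqP; ring.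
rewrite /chain_lin lE /dfield_p /dfield_q; move: (forcing _ _ _ _) => f.
have -> : (2%:R : R[i]) = (2%:R : R)%:C%C by rewrite rmorph_nat.
by apply/eqP; rewrite eq_complex /=; apply/andP; split; apply/eqP; ring.
Qed.

Hypothesis n_gt0 : (0 < n)%N.

Lemma vector_field_p eps gamma omega beta v (j : 'I_N) :
  vector_field (eps, gamma, omega) beta v 0 (lshift N j) =
  field_p n eps gamma omega beta (site (lsubmx v)) (site (rsubmx v)) j.
Proof.
rewrite /vector_field row_mxEl mxE laplacianE // /field_p /forcing !siteE eqSS.
by ring.
Qed.

Lemma vector_field_q eps gamma omega beta v (j : 'I_N) :
  vector_field (eps, gamma, omega) beta v 0 (rshift N j) =
  field_q n eps gamma omega beta (site (lsubmx v)) (site (rsubmx v)) j.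
Proof.
rewrite /vector_field row_mxEr mxE laplacianE // /field_q /forcing !siteE eqSS.
by ring.
Qed.

Lemma amplitude_vector_field eps gamma omega beta v k : (k <= n)%N ->
  amplitude (vector_field (eps, gamma, omega) beta v) k =
  chain_field n eps gamma omega beta (amplitude v) k.
Proof.
move=> kn; pose j := Ordinal (kn : (k < N)%N).
rewrite /amplitude chain_fieldE -[k]/(nat_of_ord j) !siteE.
rewrite -vector_field_p -vector_field_q; congr Complex; by rewrite mxE.
Qed.

Lemma stationaryE eps gamma omega beta p q :
  stationary (eps, gamma, omega) beta p q <->
  chain_stationary n eps gamma omega beta (amplitude (row_mx p q)).
Proof.
split=> [h|[_ h]].
  split=> [k|k kn]; first exact: amplitude_out.
  rewrite -amplitude_vector_field // h /amplitude; congr Complex;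
    by rewrite -[k]/(nat_of_ord (Ordinal (kn : (k < N)%N))) siteE !mxE.
apply: amplitude_inj => k kn; rewrite amplitude_vector_field // h // /amplitude.
by congr Complex; rewrite -[k]/(nat_of_ord (Ordinal (kn : (k < N)%N))) siteE !mxE.
Qed.

Lemma is_derive_site_l v w k :
  is_derive v w (fun y => site (lsubmx y) k) (site (lsubmx w) k).
Proof.
apply: is_derive_affine => h; have [kn|kn] := ltnP k N; last first.
  by rewrite !site_out // mulr0 addr0.
by rewrite -[k]/(nat_of_ord (Ordinal kn)) !siteE !mxE.
Qed.

Lemma is_derive_site_r v w k :
  is_derive v w (fun y => site (rsubmx y) k) (site (rsubmx w) k).
Proof.
apply: is_derive_affine => h; have [kn|kn] := ltnP k N; last first.
  by rewrite !site_out // mulr0 addr0.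
by rewrite -[k]/(nat_of_ord (Ordinal kn)) !siteE !mxE.
Qed.

End Coordinates.

Section Jacobian.
Variables (R : realType) (n : nat).
Hypothesis n_gt0 : (0 < n)%N.
Local Notation N := n.+1.
Implicit Types (p q : 'rV[R]_N) (v w : 'rV[R]_(N + N)).

Lemma differentiable_rV (V : normedModType R) m (f : V -> 'rV[R]_m) x :
  (forall i, differentiable (fun y => f y 0 i) x) -> differentiable f x.
Proof.
move=> h.
have -> : f = \sum_(i < m) (fun y => f y 0 i *: delta_mx 0 i).
  apply/funext => y; rewrite fct_sumE; apply/rowP => i.
  rewrite summxE (bigD1 i) //= !mxE !eqxx mulr1 big1 ?addr0 // => j ji.
  by rewrite !mxE eqxx eq_sym (negbTE ji) mulr0.
by apply: differentiable_sum => i; exact: differentiableZl.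
Qed.

Lemma differentiable_site_l v k : differentiable (fun y : 'rV[R]_(N + N) => site (lsubmx y) k) v.
Proof.
have [kn|kn] := ltnP k N.
  have -> : (fun y : 'rV[R]_(N + N) => site (lsubmx y) k)
      = (fun y => y 0 (lshift N (Ordinal kn))).
    by apply/funext => y; rewrite -[k]/(nat_of_ord (Ordinal kn)) siteE mxE.
  exact: differentiable_coord.
have -> : (fun y : 'rV[R]_(N + N) => site (lsubmx y) k) = cst 0.
  by apply/funext => y; rewrite site_out.
exact: differentiable_cst.
Qed.

Lemma differentiable_site_r v k : differentiable (fun y : 'rV[R]_(N + N) => site (rsubmx y) k) v.
Proof.
have [kn|kn] := ltnP k N.
  have -> : (fun y : 'rV[R]_(N + N) => site (rsubmx y) k)
      = (fun y => y 0 (rshift N (Ordinal kn))).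
    by apply/funext => y; rewrite -[k]/(nat_of_ord (Ordinal kn)) siteE mxE.
  exact: differentiable_coord.
have -> : (fun y : 'rV[R]_(N + N) => site (rsubmx y) k) = cst 0.
  by apply/funext => y; rewrite site_out.
exact: differentiable_cst.
Qed.

Lemma differentiable_lapf (V : normedModType R) (Q : nat -> V -> R) x k :
  (forall j, differentiable (Q j) x) -> differentiable (fun y => lapf n (fun j => Q j y) k) x.
Proof.
by move=> hQ; rewrite /lapf; case: k => [|k]; apply: differentiableB;
  [apply: differentiableD|apply: differentiableM|apply: differentiableD|apply: differentiableM].
Qed.

Lemma differentiable_vector_field eps gamma omega beta v :
  differentiable (@vector_field R N (eps, gamma, omega) beta) v.
Proof.
have hl := differentiable_site_l v; have hr := differentiable_site_r v.
apply: differentiable_rV => i; rewrite -(splitK i); case: (fintype.split i) => j /=.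
- have -> : (fun y => vector_field (eps, gamma, omega) beta y 0 (lshift N j)) =
    (fun y => field_p n eps gamma omega beta (site (lsubmx y)) (site (rsubmx y)) j).
    by apply/funext => y; rewrite vector_field_p.
  rewrite /field_p.
  apply: differentiableD; last by apply: differentiableM.
  apply: differentiableB; last first.
    by apply: differentiableM => //; apply: differentiableD; apply: differentiableM.
  by apply: differentiableD; apply: differentiableM => //; exact: differentiable_lapf.
- have -> : (fun y => vector_field (eps, gamma, omega) beta y 0 (rshift N j)) =
    (fun y => field_q n eps gamma omega beta (site (lsubmx y)) (site (rsubmx y)) j).
    by apply/funext => y; rewrite vector_field_q.
  rewrite /field_q.
  apply: differentiableD; last by apply: differentiableM.
  apply: differentiableD; last first.
    by apply: differentiableM => //; apply: differentiableD; apply: differentiableM.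
  by apply: differentiableB; apply: differentiableM => //; exact: differentiable_lapf.
Qed.

(** By differentiability the Jacobian computes directional derivatives, and these
    are found coordinate by coordinate. *)
Lemma amplitude_jacobian eps gamma omega beta v w k : (k <= n)%N ->
  amplitude (w *m jacobian (vector_field (eps, gamma, omega) beta) v) k =
  chain_lin n eps gamma omega beta (amplitude v) (amplitude w) (fun j => conjc (amplitude w j)) k.
Proof.
move=> kn; have df := differentiable_vector_field eps gamma omega beta v.
rewrite -deriveEjacobian // derive_mx; last exact: diff_derivable.
rewrite /amplitude chain_linE; pose j := Ordinal (kn : (k < N)%N).
rewrite -[k]/(nat_of_ord j) !siteE mxE [X in Complex _ X]mxE !mxE.
have hl := is_derive_site_l v w; have hr := is_derive_site_r v w.
have hc (c : R) : is_derive v w (fun=> c) 0 by exact: is_derive_cst.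
congr Complex.
- have := is_derive_field_p n (hc eps) (hc gamma) (hc omega) (hc beta) hl hr j.
  rewrite !mul0r !addr0 => /(@derive_val _ _ _ _ _ _ _) <-.
  by congr (derive _ _ _); apply/funext => y; rewrite vector_field_p.
- have := is_derive_field_q n (hc eps) (hc gamma) (hc omega) (hc beta) hl hr j.
  rewrite !mul0r subr0 !addr0 => /(@derive_val _ _ _ _ _ _ _) <-.
  by congr (derive _ _ _); apply/funext => y; rewrite vector_field_q.
Qed.

End Jacobian.

(** * Kernel and eigenvectors of the Jacobian *)

Section Eigenvectors.
Variables (R : realType) (n : nat).
Hypothesis n_gt0 : (0 < n)%N.
Local Notation N := n.+1.
Implicit Types (p q : 'rV[R]_N) (v w : 'rV[R]_(N + N)).
Variables (eps gamma omega beta : R) (v : 'rV[R]_(N + N)).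
Let J := jacobian (@vector_field R N (eps, gamma, omega) beta) v.

Lemma amplitude_row_mx p q k : amplitude (row_mx p q) k = Complex (site p k) (site q k).
Proof. by rewrite /amplitude row_mxKl row_mxKr. Qed.

Lemma siteN p k : site (- p) k = - site p k.
Proof.
have [kn|kn] := ltnP k N; last by rewrite !site_out ?oppr0.
by rewrite -[k]/(nat_of_ord (Ordinal kn)) !siteE mxE.
Qed.

Lemma chain_lin_rotation u k :
  chain_lin n eps gamma omega beta u (fun j => 'i%C * u j)
    (fun j => conjc ('i%C * u j)) k = 'i%C * chain_field n eps gamma omega beta u k.
Proof.
rewrite /chain_lin /chain_field.
have -> : lapf n (fun j => 'i%C * u j) k = 'i%C * lapf n u k.
  by rewrite /lapf; case: k => [|k]; ring.
by rewrite !conjcE; ring.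
Qed.

(** Rotations commute with the field, so at a stationary state the infinitesimal
    rotation [i u] is in the kernel of the derivative. *)
Lemma rotation_generator_ker p q :
  v = row_mx p q -> stationary (eps, gamma, omega) beta p q ->
  rotation_generator p q *m J = 0.
Proof.
move=> vE /stationaryE - /(_ n_gt0) [_ st]; rewrite -vE in st.
apply: amplitude_inj => k kn; rewrite amplitude_jacobian //.
have gE j : amplitude (rotation_generator p q) j = 'i%C * amplitude v j.
  rewrite /rotation_generator vE !amplitude_row_mx siteN.
  by apply/eqP; rewrite eq_complex /=; apply/andP; split; apply/eqP; ring.
have -> : amplitude (rotation_generator p q) = fun j => 'i%C * amplitude v j by apply/funext.
by rewrite chain_lin_rotation st // mulr0 -row_mx0 amplitude_row_mx /site; case: insubP => *; rewrite ?mxE.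
Qed.

Lemma chain_linD u x1 x2 y1 y2 a k :
  chain_lin n eps gamma omega beta u (fun j => x1 j + a * x2 j) (fun j => y1 j + a * y2 j) k =
  chain_lin n eps gamma omega beta u x1 y1 k + a * chain_lin n eps gamma omega beta u x2 y2 k.
Proof. by rewrite /chain_lin /lapf; case: k => [|k]; ring. Qed.

Lemma chain_lin_conjD u x1 x2 y1 y2 a k :
  chain_lin_conj n eps gamma omega beta u (fun j => x1 j + a * x2 j) (fun j => y1 j + a * y2 j) k =
  chain_lin_conj n eps gamma omega beta u x1 y1 k
  + a * chain_lin_conj n eps gamma omega beta u x2 y2 k.
Proof. by rewrite /chain_lin_conj /lapf; case: k => [|k]; ring. Qed.

(** For the halves [P] and [Q] of a complex eigenvector, [x = P + iQ] and
    [y = P - iQ] are independent unknowns; on real vectors they are conjugate.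
    The vector is split into its real and imaginary parts, to which
    [amplitude_jacobian] applies. *)
Lemma eigenvalue_chain_eigen z :
  root (char_poly (map_mx (real_complex R) J)) z ->
  exists x y, chain_eigen n eps gamma omega beta (amplitude v) z x y /\
    exists2 k, (k <= n)%N & 0 < modulus (x k) + modulus (y k).
Proof.
rewrite -eigenvalue_root_char => /eigenvalueP[w wJ w0].
pose a := map_mx (@complex.Re R) w; pose b := map_mx (@complex.Im R) w.
have wE i : w 0 i = (a 0 i)%:C%C + 'i%C * (b 0 i)%:C%C by rewrite !mxE -complexE.
have coord i : z * w 0 i = ((a *m J) 0 i)%:C%C + 'i%C * ((b *m J) 0 i)%:C%C.
  have -> : z * w 0 i = (w *m map_mx (real_complex R) J) 0 i by rewrite wJ mxE.
  rewrite [LHS]mxE [(a *m J) 0 i]mxE [(b *m J) 0 i]mxE !rmorph_sum mulr_sumr -big_split /=.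
  apply: eq_bigr => j _; rewrite wE [X in _ * X = _]mxE.
  have toCM (c d : R) : (c * d)%:C%C = c%:C%C * d%:C%C by rewrite rmorphM.
  by rewrite !toCM; ring.
have cxE (c : 'rV[R]_(N + N)) (j : 'I_N) :
    amplitude c j = (c 0 (lshift N j))%:C%C + 'i%C * (c 0 (rshift N j))%:C%C.
  by rewrite /amplitude !siteE !mxE [LHS]complexE.
pose x k := amplitude a k + 'i%C * amplitude b k.
pose y k := conjc (amplitude a k) + 'i%C * conjc (amplitude b k).
have xE (j : 'I_N) : x j = w 0 (lshift N j) + 'i%C * w 0 (rshift N j).
  by rewrite /x !cxE !wE; ring.
have yE (j : 'I_N) : y j = w 0 (lshift N j) - 'i%C * w 0 (rshift N j).
  by rewrite /y !cxE !wE !conjcE; ring.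
exists x, y; split; last first.
  have /rV0Pn[i wi] := w0.
  have [j xy] : exists j : 'I_N, x j != 0 \/ y j != 0.
    move: wi; rewrite -(splitK i); case: (fintype.split i) => j /= wj; exists j.
      have [x0|] := eqVneq (x j) 0; last by left.
      have [y0|] := eqVneq (y j) 0; last by right.
      have : 2%:R * w 0 (lshift N j) = x j + y j by rewrite xE yE; ring.
      rewrite x0 y0 addr0 => /eqP; rewrite mulf_eq0 pnatr_eq0 /= => w00.
      by rewrite w00 in wj.
    have [x0|] := eqVneq (x j) 0; last by left.
    have [y0|] := eqVneq (y j) 0; last by right.
    have : 2%:R * w 0 (rshift N j) = - 'i%C * (x j - y j).
      have i2 := sqr_i R; rewrite expr2 in i2; rewrite xE yE; ring: i2.
    rewrite x0 y0 subr0 mulr0 => /eqP; rewrite mulf_eq0 pnatr_eq0 /= => w00.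
    by rewrite w00 in wj.
  exists j; first by rewrite -ltnS.
  have m1 := modulus_ge0 (x j); have m2 := modulus_ge0 (y j).
  by case: xy => /modulus_gt0 h; [rewrite ltr_wpDr | rewrite ltr_wpDl].
split=> k kn; first by rewrite /x /y !amplitude_out // conjc0 mulr0 addr0.
pose j := Ordinal (kn : (k < N)%N).
have ja := amplitude_jacobian n_gt0 eps gamma omega beta v a kn.
have jb := amplitude_jacobian n_gt0 eps gamma omega beta v b kn.
rewrite -/J in ja jb.
split.
  rewrite /x /y chain_linD -ja -jb -/(x k) -[k]/(nat_of_ord j) !cxE xE [RHS]mulrDr.
  by rewrite (mulrCA z) !coord; ring.
rewrite /x /y chain_lin_conjD.
have cE (c : 'rV[R]_(N + N)) : amplitude (c *m J) k = chain_lin n eps gamma omega beta (amplitude v) (amplitude c)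
      (fun j => conjc (amplitude c j)) k ->
    chain_lin_conj n eps gamma omega beta (amplitude v) (amplitude c) (fun j => conjc (amplitude c j)) k
    = conjc (amplitude (c *m J) k).
  move=> ->; rewrite chain_lin_conjE; congr (chain_lin_conj _ _ _ _ _ _ _ _ _).
  by apply/funext => i; rewrite conjcK.
rewrite !cE // -/(y k) -[k]/(nat_of_ord j) !cxE yE [RHS]mulrBr (mulrCA z) !coord !conjcE.
by ring.
Qed.

End Eigenvectors.

Section UncoupledJacobian.
Variables (R : realType) (n : nat).
Hypothesis n_gt0 : (0 < n)%N.
Local Notation N := n.+1.

Lemma amplitude_head_p k : amplitude (head_p R n) k = (k == 0%N)%:R.
Proof.
rewrite amplitude_row_mx; have [kn|kn] := ltnP k N; last first.
  by rewrite !site_out //; case: eqP kn => // ->.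
rewrite -[k]/(nat_of_ord (Ordinal kn)) !siteE !mxE eqxx /=.
by rewrite -(rmorph_nat (real_complex R)).
Qed.

Lemma jacobian_uncoupled :
  jacobian (@vector_field R N (0, 0, 1) 0) (head_p R n) = uncoupled_mx R n.
Proof.
apply/row_matrixP => i; rewrite !rowE; move: (delta_mx 0 i) => w.
have -> : w *m uncoupled_mx R n =
    row_mx (rsubmx w *m diag_mx (\row_j (if j == 0 then 0 else 1)))
           (lsubmx w *m diag_mx (\row_j (if j == 0 then 2 else -1))).
  by rewrite -{1}(hsubmxK w) mul_row_block !mulmx0 add0r addr0.
apply: amplitude_inj => k kn; rewrite amplitude_jacobian // amplitude_row_mx.
pose j := Ordinal (kn : (k < N)%N).
rewrite /chain_lin amplitude_head_p /amplitude -[k]/(nat_of_ord j) !siteE !mul_mx_diag !mxE.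
rewrite /forcing !mul0r subr0 rmorph0 !mulr0 mul0r rmorph1.
have -> : (j == 0) = (k == 0%N) by [].
have -> : (2%:R : R[i]) = (2%:R : R)%:C%C by rewrite rmorph_nat.
by case: (k == 0%N); apply/eqP; rewrite eq_complex /=; apply/andP; split; apply/eqP; ring.
Qed.

End UncoupledJacobian.

(** * Continuity *)

Section Continuity.
Variables (R : realType) (X : topologicalType) (x0 : X).

Definition cont_at (f : X -> R) := {for x0, continuous f}.

Lemma cont_const (c : R) : cont_at (fun=> c).
Proof. exact: cvg_cst. Qed.

Lemma contD (f g : X -> R) : cont_at f -> cont_at g -> cont_at (fun x => f x + g x).
Proof. by move=> hf hg; exact: cvgD. Qed.

Lemma contM (f g : X -> R) : cont_at f -> cont_at g -> cont_at (fun x => f x * g x).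
Proof. by move=> hf hg; exact: cvgM. Qed.

Lemma contN (f : X -> R) : cont_at f -> cont_at (fun x => - f x).
Proof. by move=> hf; exact: cvgN. Qed.

Lemma contV (f : X -> R) : f x0 != 0 -> cont_at f -> cont_at (fun x => (f x)^-1).
Proof. by move=> h hf; exact: cvgV. Qed.

Lemma cont_sum (I : Type) (r : seq I) (P : pred I) (f : I -> X -> R) :
  (forall i, cont_at (f i)) -> cont_at (fun x => \sum_(i <- r | P i) f i x).
Proof.
move=> hf; elim: r => [|a r IH].
  by rewrite (_ : (fun=> _) = fun=> 0); [exact: cont_const | apply/funext => x; rewrite big_nil].
rewrite (_ : (fun=> _) = fun x => (if P a then f a x else 0) + \sum_(i <- r | P i) f i x).
  by apply: contD => //; case: (P a) => //; exact: cont_const.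
by apply/funext => x; rewrite big_cons; case: (P a); rewrite ?add0r.
Qed.

(** Continuity of polynomials is meant coefficient by coefficient. *)
Definition coefs_cont (f : X -> {poly R}) := forall i, cont_at (fun x => (f x)`_i).

Lemma coefs_const (p : {poly R}) : coefs_cont (fun=> p).
Proof. by move=> i; exact: cont_const. Qed.

Lemma coefsC (f : X -> R) : cont_at f -> coefs_cont (fun x => (f x)%:P).
Proof.
move=> hf i; rewrite (_ : (fun=> _) = fun x => if i == 0%N then f x else 0).
  by case: (i == 0%N) => //; exact: cont_const.
by apply/funext => x; rewrite coefC.
Qed.

Lemma coefsD f g : coefs_cont f -> coefs_cont g -> coefs_cont (fun x => f x + g x).
Proof.
move=> hf hg i; rewrite (_ : (fun=> _) = fun x => (f x)`_i + (g x)`_i).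
  exact: contD.
by apply/funext => x; rewrite coefD.
Qed.

Lemma coefsN f : coefs_cont f -> coefs_cont (fun x => - f x).
Proof.
move=> hf i; rewrite (_ : (fun=> _) = fun x => - (f x)`_i); first exact: contN.
by apply/funext => x; rewrite coefN.
Qed.

Lemma coefsM f g : coefs_cont f -> coefs_cont g -> coefs_cont (fun x => f x * g x).
Proof.
move=> hf hg i; rewrite (_ : (fun=> _) = fun x => \sum_(j < i.+1) (f x)`_j * (g x)`_(i - j)).
  by apply: cont_sum => j; exact: contM.
by apply/funext => x; rewrite coefM.
Qed.

Lemma coefs_sum (I : Type) (r : seq I) (P : pred I) (f : I -> X -> {poly R}) :
  (forall i, coefs_cont (f i)) -> coefs_cont (fun x => \sum_(i <- r | P i) f i x).
Proof.
move=> hf; elim: r => [|a r IH].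
  by rewrite (_ : (fun=> _) = fun=> 0); [exact: coefs_const | apply/funext => x; rewrite big_nil].
rewrite (_ : (fun=> _) = fun x => (if P a then f a x else 0) + \sum_(i <- r | P i) f i x).
  by apply: coefsD => //; case: (P a) => //; exact: coefs_const.
by apply/funext => x; rewrite big_cons; case: (P a); rewrite ?add0r.
Qed.

Lemma coefs_prod (I : Type) (r : seq I) (P : pred I) (f : I -> X -> {poly R}) :
  (forall i, coefs_cont (f i)) -> coefs_cont (fun x => \prod_(i <- r | P i) f i x).
Proof.
move=> hf; elim: r => [|a r IH].
  by rewrite (_ : (fun=> _) = fun=> 1); [exact: coefs_const | apply/funext => x; rewrite big_nil].
rewrite (_ : (fun=> _) = fun x => (if P a then f a x else 1) * \prod_(i <- r | P i) f i x).
  by apply: coefsM => //; case: (P a) => //; exact: coefs_const.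
by apply/funext => x; rewrite big_cons; case: (P a); rewrite ?mul1r.
Qed.

Lemma coefs_det m (M : X -> 'M[{poly R}]_m) :
  (forall i j, coefs_cont (fun x => M x i j)) -> coefs_cont (fun x => \det (M x)).
Proof.
move=> hM; rewrite /determinant; apply: coefs_sum => s.
by apply: coefsM; [exact: coefs_const | apply: coefs_prod].
Qed.

Lemma coefs_adj_coord m (J : X -> 'M[R]_m) (v : X -> 'rV[R]_m) k :
  (forall i j, cont_at (fun x => J x i j)) -> (forall j, cont_at (fun x => v x 0 j)) ->
  coefs_cont (fun x => adj_coord (J x) (v x) k).
Proof.
move=> hJ hv.
rewrite (_ : (fun=> _) = fun x => \sum_j (v x 0 j)%:P * \adj (char_poly_mx (J x)) j k).
  apply: coefs_sum => j; apply: coefsM; first exact: coefsC.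
  rewrite (_ : (fun=> _) = fun x => (-1) ^+ (k + j) *
      \det (\matrix_(a, b) char_poly_mx (J x) (lift k a) (lift j b))).
    apply: coefsM; first exact: coefs_const.
    apply: coefs_det => a b.
    rewrite (_ : (fun=> _) = fun x => 'X *+ (lift k a == lift j b) - (J x (lift k a) (lift j b))%:P).
      by apply: coefsD; [exact: coefs_const | apply: coefsN; exact: coefsC].
    by apply/funext => x; rewrite !mxE.
  apply/funext => x; rewrite mxE /cofactor; congr (_ * \det _).
  by apply/matrixP => a b; rewrite !mxE.
by apply/funext => x; rewrite /adj_coord mxE; apply: eq_bigr => j _; rewrite mxE.
Qed.

End Continuity.

(** * The spectrum at one parameter value *)

Section Spectrum.
Variables (R : realType) (n : nat).
Hypothesis n_gt0 : (0 < n)%N.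
Local Notation N := n.+1.
Local Notation toC := (real_complex R).
Variables (tau r C eps gamma omega beta b : R) (v w : 'rV[R]_(N + N)).
Local Notation J := (jacobian (@vector_field R N (eps, gamma, omega) beta) v).
Local Notation u := (amplitude v).
Local Notation k0 := (head_q_index n).
Local Notation a := (complex.Re (u 0%N)).

(** Pointwise form of the result: the inequalities among [tau], [r] and [C] say
    that the parameter is close enough to the base point, and the bounds on the
    coefficients of [adj_coord] are what continuity provides there.  The factor
    [X D_h + b D_e] of [char_poly_split] satisfies the hypotheses of
    [small_root]; the roots of the remaining factor stay away from 0, and
    [eigenvalue_Re_lt0] applies to them. *)
Lemma spectrum :
  16 ^+ n * tau <= 200^-1 -> 0 < r -> r <= 1 -> 56 * tau < r ^+ 2 ->
  120 * tau <= r -> 0 <= C -> 10 * tau * C <= 4^-1 ->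
  (n + n).+2%:R * (2 * C * ((n + n).+2%:R * r)) <= 4^-1 ->
  near_single_site tau eps gamma omega u ->
  chain_stationary n eps gamma omega beta u -> eps != 0 ->
  (forall k, (k <= n)%N -> chain_lin n eps gamma omega beta u (amplitude w)
     (fun j => conjc (amplitude w j)) k = 'i%C * u k - (b * (k == 0%N)%:R)%:C%C * u k) ->
  (forall k, (0 < k)%N -> modulus (amplitude w k) <= tau) -> modulus (amplitude w 0%N) <= 1 ->
  b * modulus (u 0%N) ^+ 2 + 2 * beta * complex.Re (conjc (u 0%N) * amplitude w 0%N)
    = 2 * gamma * complex.Re (conjc (u n) * amplitude w n) ->
  complex.Im (u 0%N) = 0 -> complex.Im (amplitude w 0%N) = 0 ->
  (forall k, (k < (n + n).+2)%N -> `|(adj_coord J w k0)`_k| <= C) ->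
  (forall k, (k < (n + n).+2)%N -> `|(adj_coord J (a *: head_p R n) k0)`_k| <= C) ->
  3 / 4 <= (adj_coord J w k0)`_0 ->
  1 <= (adj_coord J (a *: head_p R n) k0)`_0 <= 3 ->
  exists (lambda : R) (s : seq R[i]),
  [/\ 0 < lambda, lambda <= 120 * gamma, size s = (n + n)%N,
      forall z, z \in s -> complex.Re z < 0 &
      char_poly (map_mx toC J) = \prod_(z <- [:: 0, toC lambda & s]) ('X - z%:P)].
Proof.
move=> tau16 r0 r1 taur taur2 C0 tauC Cr near stat eps0 slope wtail w0 bal ui wi DhC DeC Dh0
  /andP[De0 De0'].
have e16 : 1 <= 16 ^+ n :> R by apply: exprn_ege1; lra.
have tau0 := tau_ge0 near.
have tau1 : tau <= 200^-1 by nra.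
have g0 := nss_gamma0 near; have gt := nss_gamma near.
have b_lt0 : b < 0.
  exact: (driving_slope_lt0 n_gt0 tau1 near stat eps0 (fun k kn => amplitude_out w kn) slope wtail bal).
have b_le : `|b| <= 10 * gamma.
  exact: (driving_slope_le n_gt0 tau1 near stat wtail bal w0).
have a0 : 0 < a.
  have h := nss_head near; have h2 := Re_le_modulus (u 0%N - 1).
  have : complex.Re (u 0%N - 1) = a - 1 by rewrite raddfB.
  move: h2; rewrite ler_norml => /andP[]; lra.
pose g := rotation_generator (lsubmx v) (rsubmx v).
have st : stationary (eps, gamma, omega) beta (lsubmx v) (rsubmx v).
  by apply/(stationaryE n_gt0); rewrite hsubmxK.
have gJ : g *m J = 0 by apply: rotation_generator_ker => //; rewrite hsubmxK.
have gE j : amplitude g j = 'i%C * u j.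
  rewrite /g /rotation_generator amplitude_row_mx siteN /amplitude.
  by apply/eqP; rewrite eq_complex /=; apply/andP; split; apply/eqP; ring.
have wJ : w *m J = g - b *: (a *: head_p R n).
  apply: amplitude_inj => k kn; rewrite amplitude_jacobian // slope //.
  have cxB (c d : 'rV[R]_(N + N)) : amplitude (c - d) k = amplitude c k - amplitude d k.
    by rewrite /amplitude -[k]/(nat_of_ord (Ordinal (kn : (k < N)%N))) !siteE !mxE.
  have cxZ x (c : 'rV[R]_(N + N)) : amplitude (x *: c) k = x%:C%C * amplitude c k.
    rewrite /amplitude -[k]/(nat_of_ord (Ordinal (kn : (k < N)%N))) !siteE !mxE.
    by apply/eqP; rewrite eq_complex /=; apply/andP; split; apply/eqP; ring.
  rewrite cxB !cxZ gE amplitude_head_p; congr (_ - _).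
  have toCM (c d : R) : (c * d)%:C%C = c%:C%C * d%:C%C by rewrite rmorphM.
  rewrite toCM rmorph_nat -mulrA; congr (_ * _).
  have [->|_] := eqVneq k 0%N; last by rewrite mulr0 mul0r.
  by rewrite mul1r mulr1 [LHS]complexE ui rmorph0 mulr0 addr0.
have wk : w 0 k0 = 0.
  by move: wi; rewrite /amplitude /= -[0%N]/(nat_of_ord (ord0 : 'I_N)) siteE mxE.
have gk : g 0 k0 = a.
  rewrite /g /rotation_generator row_mxEr mxE /amplitude /=.
  by rewrite -[0%N]/(nat_of_ord (ord0 : 'I_N)) siteE mxE.
have split := char_poly_split gJ wJ wk; rewrite gk in split.
set Dh := adj_coord J w k0 in DhC Dh0 split.
set De := adj_coord J _ k0 in DeC De0 De0' split.
set psi := 'X * Dh + b%:P * De in split.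
have aP : a%:P != 0 :> {poly R} by rewrite polyC_eq0 gt_eqF.
have chi0 : char_poly J != 0 by rewrite monic_neq0 ?char_poly_monic.
have spsi : (size psi <= (n + n).+2)%N.
  have psi0 : psi != 0.
    by apply: contraNneq chi0 => p0; move/eqP: split; rewrite p0 mulr0 mulf_eq0 (negbTE aP).
  have := congr1 (fun t : {poly R} => size t) split.
  rewrite mul_polyC size_scale ?gt_eqF // size_char_poly (mulrC 'X) size_mulX // => -[<-].
  by rewrite addnS addSn.
have b1 : `|b| <= 10 * tau by apply: le_trans b_le _; lra.
have psiC k : `|psi`_k| <= 2 * C.
  have [kn|kn] := ltnP k (n + n).+2; last first.
    by rewrite nth_default ?normr0 ?mulr_ge0 //; exact: leq_trans kn.
  rewrite /psi coefD coefXM coefCM.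
  apply: le_trans (ler_normD _ _) _.
  have h1 : `|(if k == 0%N then 0 else Dh`_k.-1)| <= C.
    by case: k kn => [|k] kn /=; rewrite ?normr0 // DhC // ltnW.
  have h2 : `|b * De`_k| <= 1 * C.
    by rewrite normrM; apply: ler_pM => //; [lra | exact: DeC].
  lra.
have psi0 : psi`_0 = b * De`_0 by rewrite /psi coefD coefXM coefCM add0r.
have psi1 : 2^-1 <= psi`_1.
  rewrite /psi coefD coefXM coefCM /=.
  have h : `|b * De`_1| <= 10 * tau * C.
    by rewrite normrM; apply: ler_pM => //; exact: DeC.
  by move: h; rewrite ler_norml => /andP[h _]; lra.
have psi0_lt0 : psi`_0 < 0 by rewrite psi0 nmulr_rlt0 //; lra.
have psi0_le : 4 * `|psi`_0| <= 120 * gamma.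
  rewrite psi0 normrM (ger0_norm (x := De`_0)); last lra.
  have : `|b| * De`_0 <= 10 * gamma * 3 by apply: ler_pM => //; lra.
  lra.
have [||lambda [rho [l0 ll prho rhor]]] := small_root _ r0 r1 Cr spsi psiC psi1 psi0_lt0.
- by rewrite mulr_ge0.
- by lra.
have mapJ : char_poly (map_mx toC J) = map_poly toC (char_poly J) by rewrite map_char_poly.
have chiE : char_poly J = a^-1 *: ('X * (rho * ('X - lambda%:P))).
  by rewrite -prho -split -mul_polyC mulrA -polyCM mulVf ?gt_eqF // mul1r.
have [s sE] := closed_field_poly_normal (map_poly toC rho).
set c := lead_coef _ in sE.
have prodE : char_poly (map_mx toC J) =
    (toC a^-1 * c) *: \prod_(z <- [:: 0, toC lambda & s]) ('X - z%:P).
  have mapM (f h : {poly R}) : map_poly toC (f * h) = map_poly toC f * map_poly toC h.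
    exact: rmorphM.
  have mapB (f h : {poly R}) : map_poly toC (f - h) = map_poly toC f - map_poly toC h.
    exact: rmorphB.
  rewrite mapJ chiE -mul_polyC !mapM sE mapB map_polyX !map_polyC !big_cons.
  by rewrite polyC0 subr0 -!mul_polyC polyCM; ring.
have lc : toC a^-1 * c = 1.
  have m1 := char_poly_monic (map_mx toC J); have m2 := monic_prod_XsubC [:: 0, toC lambda & s] xpredT id.
  by move: m1; rewrite prodE monicE lead_coefZ (monicP m2) mulr1 => /eqP.
rewrite lc scale1r in prodE.
exists lambda, s; split=> //; first exact: le_trans ll psi0_le.
  have := size_char_poly (map_mx toC J); rewrite prodE size_prod_XsubC /=.
  by move=> -[]; clear; lia.
move=> z zs.
have zrho : root (map_poly toC rho) z.
  by rewrite sE rootZ ?root_prod_XsubC // ; apply: contra_eq_neq lc => ->; rewrite mulr0 eq_sym oner_eq0.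
have zchi : root (char_poly (map_mx toC J)) z.
  by rewrite prodE root_prod_XsubC !inE zs !orbT.
have [x [y [eig nz]]] := eigenvalue_chain_eigen n_gt0 zchi.
exact: (eigenvalue_Re_lt0 n_gt0 tau1 near stat tau16 eps0 r0 r1 taur (rhor _ zrho) eig nz).
Qed.

End Spectrum.

(** * The breather family near the uncoupled limit *)

Section Family.
Local Open Scope classical_set_scope.
Local Open Scope ring_scope.
Variables (R : realType) (n : nat).
Hypothesis n_gt0 : (0 < n)%N.
Local Notation N := n.+1.
Variables (beta : R * R * R -> R) (p q : R * R * R -> 'rV[R]_N).
Variables (U : set (R * R * R)) (rho : R).
Local Notation x0 := ((0, 0, 1) : R * R * R).
(* the direction of increasing omega; it has the same coordinates as the base
   point x0, the uncoupled chain at omega = 1 *)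
Local Notation domega := ((0, 0, 1) : R * R * R).
Hypothesis openU : open U.
Hypothesis Ux0 : U x0.
Hypothesis rho_gt0 : 0 < rho.
Hypothesis br : forall x, U x -> is_breather rho x (beta x) (p x) (q x).
Hypothesis smooth_p : smooth_on U p.
Hypothesis smooth_q : smooth_on U q.

Definition state x : 'rV[R]_(N + N) := row_mx (p x) (q x).
Definition slope x : 'rV[R]_(N + N) := row_mx ('D_domega p x) ('D_domega q x).

Lemma near_U x : U x -> \forall y \near x, U y.
Proof. by move=> Ux; apply: open_nbhs_nbhs; split. Qed.

Lemma state_stationary x : U x ->
  chain_stationary n x.1.1 x.1.2 x.2 (beta x) (amplitude (state x)).
Proof.
move=> Ux; have [st _ _ _] := br Ux; apply/(stationaryE n_gt0).
by case: x Ux st => [[e g] o].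
Qed.

Lemma site_q0 x : U x -> site (q x) 0 = 0.
Proof. by move=> Ux; have [_ _ [] ] := br Ux. Qed.

(** The one-site state is stationary without coupling, so uniqueness identifies
    it with the member of the family at the base point. *)
Lemma family_base : beta x0 = 0 /\ state x0 = head_p R n.
Proof.
have [_ _ _ uniq] := br Ux0.
have hst : stationary x0 0 (delta_mx 0 0 : 'rV[R]_N) 0.
  apply/(stationaryE n_gt0); split=> [k|k kn]; first exact: amplitude_out.
  rewrite /chain_field; have -> : amplitude (row_mx (delta_mx 0 0 : 'rV[R]_N) 0) k = (k == 0%N)%:R.
    by transitivity (amplitude (head_p R n) k); [by [] | rewrite amplitude_head_p].
  rewrite /forcing !mul0r subr0 rmorph0 rmorph1 mulr0 mul0r.
  by rewrite conjc_nat; case: (k == 0%N); rewrite /=; ring.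
have hnear : near_one_site rho (delta_mx 0 0 : 'rV[R]_N) 0.
  split; last by rewrite normr0.
  rewrite (_ : _ - _ = 0) ?normr0 //; apply/rowP => j; rewrite !mxE eqxx /=.
  by rewrite (_ : (j == 0) = (nat_of_ord j == 0%N)) // subrr.
have [<- hpq] := uniq 0 _ _ hst hnear; split=> //.
rewrite /state; have [|<- <-] := hpq; last by [].
by split; rewrite -[0%N]/(nat_of_ord (ord0 : 'I_N)) siteE mxE ?eqxx.
Qed.

Lemma is_derive_site (f : R * R * R -> 'rV[R]_N) x k : derivable f x domega ->
  is_derive x domega (fun y => site (f y) k) (site ('D_domega f x) k).
Proof.
move=> df; have [kn|kn] := ltnP k N; last first.
  rewrite site_out // (_ : (fun y => _) = cst 0); first exact: is_derive_cst.
  by apply/funext => y; rewrite site_out.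
rewrite -[k]/(nat_of_ord (Ordinal kn)) siteE derive_mx // mxE.
rewrite (_ : (fun y => _) = (fun y => f y 0 (Ordinal kn))); last first.
  by apply/funext => y; rewrite siteE.
apply: derivableP; exact: ((derivable_mxP f x domega).1 df 0 (Ordinal kn)).
Qed.

Lemma is_derive_p x k : U x -> is_derive x domega (fun y => site (p y) k) (site ('D_domega p x) k).
Proof. by move=> Ux; apply: is_derive_site; have [_ /(_ domega)[h _]] := smooth_p 1; exact: h. Qed.

Lemma is_derive_q x k : U x -> is_derive x domega (fun y => site (q y) k) (site ('D_domega q x) k).
Proof. by move=> Ux; apply: is_derive_site; have [_ /(_ domega)[h _]] := smooth_q 1; exact: h. Qed.

Lemma cont_site (f : R * R * R -> 'rV[R]_N) k : {for x0, continuous f} ->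
  cont_at x0 (fun y => site (f y) k).
Proof.
move=> cf; have [kn|kn] := ltnP k N; last first.
  rewrite (_ : (fun y => _) = fun=> 0); first exact: cont_const.
  by apply/funext => y; rewrite site_out.
rewrite (_ : (fun y => _) = (fun y => f y 0 (Ordinal kn))); last first.
  by apply/funext => y; rewrite -[k]/(nat_of_ord (Ordinal kn)) siteE.
apply: (@continuous_comp _ _ _ f (fun M : 'rV[R]_N => M 0 (Ordinal kn))) => //.
exact: coord_continuous.
Qed.

Lemma cont_p k : cont_at x0 (fun y => site (p y) k).
Proof. by apply: cont_site; have [h _] := smooth_p 0; exact: h. Qed.

Lemma cont_q k : cont_at x0 (fun y => site (q y) k).
Proof. by apply: cont_site; have [h _] := smooth_q 0; exact: h. Qed.

Lemma cont_dp k : cont_at x0 (fun y => site ('D_domega p y) k).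
Proof. by apply: cont_site; have [_ /(_ domega)[_ [h _]]] := smooth_p 1; exact: h. Qed.

Lemma cont_dq k : cont_at x0 (fun y => site ('D_domega q y) k).
Proof. by apply: cont_site; have [_ /(_ domega)[_ [h _]]] := smooth_q 1; exact: h. Qed.

Lemma modulus_sq (a b : R) : modulus (Complex a b) ^+ 2 = a * a + b * b.
Proof. by rewrite /modulus /= sqr_sqrtr ?addr_ge0 ?sqr_ge0 // !expr2. Qed.

Definition intensity k x : R := site (p x) k * site (p x) k + site (q x) k * site (q x) k.

Lemma family_balance x : U x -> beta x * intensity 0 x = x.1.2 * intensity n x.
Proof.
move=> Ux; have := power_balance n_gt0 (state_stationary Ux).
by rewrite !amplitude_row_mx !modulus_sq.
Qed.

Lemma intensity0_neq0 x : U x -> intensity 0 x != 0.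
Proof.
move=> Ux; have [_ _ [q0 p0] _] := br Ux.
by rewrite /intensity q0 mulr0 addr0 mulf_neq0 // gt_eqF.
Qed.

Lemma betaE x : U x -> beta x = x.1.2 * intensity n x * (intensity 0 x)^-1.
Proof. by move=> Ux; rewrite -family_balance // mulfK // intensity0_neq0. Qed.

Lemma is_derive_eps x : is_derive x domega (fun y : R * R * R => y.1.1) 0.
Proof. by apply: is_derive_affine => h /=; rewrite scaler0 mulr0. Qed.

Lemma is_derive_gamma x : is_derive x domega (fun y : R * R * R => y.1.2) 0.
Proof. by apply: is_derive_affine => h /=; rewrite scaler0 mulr0. Qed.

Lemma is_derive_omega x : is_derive x domega (fun y : R * R * R => y.2) 1.
Proof. by apply: is_derive_affine. Qed.

Lemma is_derive_intensity x k : U x -> is_derive x domega (intensity k)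
  (2 * (site (p x) k * site ('D_domega p x) k + site (q x) k * site ('D_domega q x) k)).
Proof.
move=> Ux; have hp := is_derive_p k Ux; have hq := is_derive_q k Ux.
rewrite /intensity; apply: is_derive_eq.
transitivity (site (p x) k * site ('D_domega p x) k + site (p x) k * site ('D_domega p x) k
  + (site (q x) k * site ('D_domega q x) k + site (q x) k * site ('D_domega q x) k)).
  by [].
by ring.
Qed.

(** By the power balance [beta] is a rational function of the parameters and the state. *)
Lemma is_derive_beta x : U x -> is_derive x domega beta ('D_domega beta x).
Proof.
move=> Ux; apply: derivableP.
have hU : \near x, (fun y => y.1.2 * intensity n y * (intensity 0 y)^-1) x = beta x.
  by near=> y; rewrite betaE //; near: y; exact: near_U.
apply: near_eq_derivable hU _.
have h1 := is_derive_gamma x; have h2 := is_derive_intensity n Ux; have h3 := is_derive_intensity 0 Ux.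
apply: derivableM; first by apply: derivableM; apply: ex_derive.
by apply: derivableV; [exact: intensity0_neq0 | apply: ex_derive].
Unshelve. all: by end_near. Qed.

Lemma balance_slope x : U x ->
  'D_domega beta x * modulus (amplitude (state x) 0%N) ^+ 2
   + 2 * beta x * complex.Re (conjc (amplitude (state x) 0%N) * amplitude (slope x) 0%N)
  = 2 * x.1.2 * complex.Re (conjc (amplitude (state x) n) * amplitude (slope x) n).
Proof.
move=> Ux; rewrite !amplitude_row_mx modulus_sq /=.
have hb := is_derive_beta Ux; have hg := is_derive_gamma x.
have hn := is_derive_intensity n Ux; have h0 := is_derive_intensity 0 Ux.
have H1 := is_deriveM hb h0; have H2 := is_deriveM hg hn.
have e : 'D_domega (beta * intensity 0) x = 'D_domega ((fun y => y.1.2) * intensity n) x.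
  apply: near_eq_derive; near=> y; apply: family_balance.
  by near: y; exact: near_U.
rewrite (@derive_val _ _ _ _ _ _ _ H1) (@derive_val _ _ _ _ _ _ _ H2) in e.
have e2 : beta x * (2 * (site (p x) 0 * site ('D_domega p x) 0 + site (q x) 0 * site ('D_domega q x) 0))
   + intensity 0 x * 'D_domega beta x = x.1.2 * (2 * (site (p x) n * site ('D_domega p x) n
   + site (q x) n * site ('D_domega q x) n)) + intensity n x * 0 by exact: e.
rewrite /intensity in e2; lra.
Unshelve. all: by end_near. Qed.

(** The stationarity equations hold on an open set, so their derivatives in
    [omega] vanish. *)
Lemma slope_equation x k : U x -> (k <= n)%N ->
  chain_lin n x.1.1 x.1.2 x.2 (beta x) (amplitude (state x)) (amplitude (slope x))
     (fun j => conjc (amplitude (slope x) j)) k =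
  'i%C * amplitude (state x) k - ('D_domega beta x * (k == 0%N)%:R)%:C%C * amplitude (state x) k.
Proof.
move=> Ux kn.
have -> : amplitude (state x) = fun j => Complex (site (p x) j) (site (q x) j).
  by apply/funext => j; rewrite amplitude_row_mx.
have -> : amplitude (slope x) = fun j => Complex (site ('D_domega p x) j) (site ('D_domega q x) j).
  by apply/funext => j; rewrite amplitude_row_mx.
rewrite chain_linE.
have zero y : U y -> field_p n y.1.1 y.1.2 y.2 (beta y) (site (p y)) (site (q y)) k = 0 /\
    field_q n y.1.1 y.1.2 y.2 (beta y) (site (p y)) (site (q y)) k = 0.
  move=> Uy; have [_ /(_ k kn)] := state_stationary Uy.
  have -> : amplitude (state y) = fun j => Complex (site (p y) j) (site (q y) j).
    by apply/funext => j; rewrite amplitude_row_mx.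
  by rewrite chain_fieldE => -[].
have hp j := is_derive_p j Ux; have hq j := is_derive_q j Ux.
have hb := is_derive_beta Ux.
have e1 := is_derive_field_p n (is_derive_eps x) (is_derive_gamma x) (is_derive_omega x) hb hp hq k.
have e2 := is_derive_field_q n (is_derive_eps x) (is_derive_gamma x) (is_derive_omega x) hb hp hq k.
have n1 : \near x, (fun y => field_p n y.1.1 y.1.2 y.2 (beta y)
    (site (p y)) (site (q y)) k) x = (cst 0 : R * R * R -> R) x.
  by near=> y; apply: (zero y _).1; near: y; exact: near_U.
have n2 : \near x, (fun y => field_q n y.1.1 y.1.2 y.2 (beta y)
    (site (p y)) (site (q y)) k) x = (cst 0 : R * R * R -> R) x.
  by near=> y; apply: (zero y _).2; near: y; exact: near_U.
have z1 := near_eq_is_derive n1 e1; have z2 := near_eq_is_derive n2 e2.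
have := @derive_val _ _ _ _ _ _ _ z1; rewrite derive_cst => d1.
have := @derive_val _ _ _ _ _ _ _ z2; rewrite derive_cst => d2.
apply/eqP; rewrite eq_complex /=; apply/andP; split; apply/eqP; lra.
Unshelve. all: by end_near. Qed.

Lemma cont_eps : cont_at x0 (fun y : R * R * R => y.1.1).
Proof. by apply: (cvg_comp fst fst); [exact: cvg_fst | exact: cvg_fst]. Qed.

Lemma cont_gamma : cont_at x0 (fun y : R * R * R => y.1.2).
Proof. by apply: (cvg_comp fst snd); [exact: cvg_fst | exact: cvg_snd]. Qed.

Lemma cont_omega : cont_at x0 (fun y : R * R * R => y.2).
Proof. exact: cvg_snd. Qed.

Lemma cont_intensity k : cont_at x0 (intensity k).
Proof. by apply: contD; apply: contM; solve [exact: cont_p | exact: cont_q]. Qed.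

Lemma cont_beta : cont_at x0 beta.
Proof.
have h : cont_at x0 (fun x => x.1.2 * intensity n x * (intensity 0 x)^-1).
  apply: contM; first by apply: contM; [exact: cont_gamma | exact: cont_intensity].
  by apply: contV; [exact: intensity0_neq0 | exact: cont_intensity].
rewrite /cont_at /= /prop_for /continuous_at betaE //.
apply: cvg_trans h; apply: near_eq_cvg; near=> x; rewrite betaE //.
by near: x; exact: near_U.
Unshelve. all: by end_near. Qed.

Lemma slope_q0 x : U x -> site ('D_domega q x) 0 = 0.
Proof.
move=> Ux; have nq : \near x, (fun y => site (q y) 0) x = (cst 0 : R * R * R -> R) x.
  by near=> y; apply: site_q0; near: y; exact: near_U.
have := near_eq_is_derive nq (is_derive_q 0 Ux).
by move=> /(@derive_val _ _ _ _ _ _ _); rewrite derive_cst.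
Unshelve. all: by end_near. Qed.

(** At the base point [slope_equation] decouples into one linear equation per
    site; the imaginary part at site 0, which it leaves free, is fixed by the
    normalization. *)
Lemma slope_base : slope x0 = 2^-1 *: head_p R n.
Proof.
have [b0 s0] := family_base.
apply: amplitude_inj => k kn.
have e := slope_equation Ux0 kn; rewrite /= b0 s0 in e.
have cz : amplitude (2^-1 *: head_p R n) k = (2^-1 * (k == 0%N)%:R)%:C%C.
  have cxZ : amplitude (2^-1 *: head_p R n) k = (2^-1)%:C%C * amplitude (head_p R n) k.
    rewrite /amplitude -[k]/(nat_of_ord (Ordinal (kn : (k < N)%N))) !siteE !mxE.
    by apply/eqP; rewrite eq_complex /=; apply/andP; split; apply/eqP; ring.
  by rewrite cxZ amplitude_head_p (rmorphM (real_complex R)) /= rmorph_nat.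
have q0 : k = 0%N -> site ('D_domega q x0) k = 0 by move=> ->; exact: slope_q0.
have wE : amplitude (slope x0) k = Complex (site ('D_domega p x0) k) (site ('D_domega q x0) k).
  exact: amplitude_row_mx.
set P := site _ k in wE; set Q := site _ k in q0 wE.
have {}e : - 'i%C * Complex P Q
    + 2%:R * 'i%C * ((k == 0%N)%:R * conjc (k == 0%N)%:R) * Complex P Q
    + 'i%C * (k == 0%N)%:R ^+ 2 * conjc (Complex P Q)
  = 'i%C * (k == 0%N)%:R - ('D_domega beta x0 * (k == 0%N)%:R)%:C%C * (k == 0%N)%:R.
  rewrite amplitude_head_p in e; rewrite -wE -e /chain_lin amplitude_head_p /forcing !mul0r subr0 rmorph0 rmorph1.
  by rewrite -[X in _ + 'i%C * _ * X + _]/(conjc (amplitude (slope x0) k)); ring.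
move: e; rewrite cz wE.
have -> : (2%:R : R[i]) = (2%:R : R)%:C%C by rewrite rmorph_nat.
rewrite -(rmorph_nat (real_complex R)).
case: eqP q0 => [k00|_] q0 /eqP; rewrite eq_complex /= => /andP[/eqP e1 /eqP e2].
  have Q0 := q0 k00; rewrite Q0 in e1 e2 *.
  by apply/eqP; rewrite eq_complex /=; apply/andP; split; apply/eqP; lra.
by apply/eqP; rewrite eq_complex /=; apply/andP; split; apply/eqP; lra.
Qed.

Lemma near_small m (f : 'I_m -> R * R * R -> R) e :
  (forall i, cont_at x0 (f i)) -> 0 < e ->
  \forall x \near x0, forall i, `|f i x - f i x0| < e.
Proof.
move=> hf e0.
apply: (@filter_forall _ 'I_m (fun i x => is_true (`|f i x - f i x0| < e)) (nbhs x0)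
  (nbhs_filter x0)) => i.
have /cvgrPdist_lt/(_ e e0) := hf i.
by apply: filterS => x; rewrite distrC.
Qed.

Lemma near_amplitude (f g : R * R * R -> 'rV[R]_N) e :
  (forall k, cont_at x0 (fun y => site (f y) k)) ->
  (forall k, cont_at x0 (fun y => site (g y) k)) -> 0 < e ->
  \forall x \near x0, forall k,
    modulus (amplitude (row_mx (f x) (g x)) k - amplitude (row_mx (f x0) (g x0)) k) <= e.
Proof.
move=> cf cg e0; have e2 : 0 < e / 2 by rewrite divr_gt0.
near=> x => k.
have hf : forall i : 'I_N, `|site (f x) i - site (f x0) i| < e / 2.
  by near: x; exact: (near_small (f := fun i y => site (f y) i)).
have hg : forall i : 'I_N, `|site (g x) i - site (g x0) i| < e / 2.
  by near: x; exact: (near_small (f := fun i y => site (g y) i)).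
have [kn|kn] := ltnP k N; last by rewrite !amplitude_out // subrr modulus0 ltW.
have {hf} hf := hf (Ordinal kn); have {hg} hg := hg (Ordinal kn).
rewrite /= in hf hg; rewrite !amplitude_row_mx.
apply: le_trans (modulus_le_ReIm _) _; rewrite /= (splitr e).
by apply: lerD; exact: ltW.
Unshelve. all: by end_near. Qed.

Lemma near_param (f : R * R * R -> R) e : cont_at x0 f -> 0 < e ->
  \forall x \near x0, `|f x - f x0| <= e.
Proof.
move=> /cvgrPdist_le/(_ e) cf e0; have := cf e0.
by apply: filterS => x; rewrite distrC.
Qed.

Lemma near_family tau : 0 < tau -> tau <= 4^-1 -> \forall x \near x0,
  [/\ 0 < x.1.2 -> near_single_site tau x.1.1 x.1.2 x.2 (amplitude (state x)),
      forall k, (0 < k)%N -> modulus (amplitude (slope x) k) <= tau &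
      modulus (amplitude (slope x) 0) <= 1].
Proof.
move=> tau0 tau1; have [_ s0] := family_base.
near=> x.
have hs k : modulus (amplitude (state x) k - (k == 0%N)%:R) <= tau.
  rewrite -(@amplitude_head_p R n) -s0; move: k; near: x.
  by apply: near_amplitude => //; [exact: cont_p | exact: cont_q].
have hd k : modulus (amplitude (slope x) k - amplitude (slope x0) k) <= tau.
  by move: k; near: x; apply: near_amplitude => //; [exact: cont_dp | exact: cont_dq].
have he : `|x.1.1 - (x0 : R * R * R).1.1| <= tau.
  by near: x; apply: near_param => //; exact: cont_eps.
have hg : `|x.1.2 - (x0 : R * R * R).1.2| <= tau.
  by near: x; apply: near_param => //; exact: cont_gamma.
have ho : `|x.2 - (x0 : R * R * R).2| <= tau.
  by near: x; apply: near_param => //; exact: cont_omega.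
have hz k : amplitude (slope x0) k = (2^-1)%:C%C * (k == 0%N)%:R.
  rewrite slope_base -(@amplitude_head_p R n); have [kn|kn] := ltnP k N; last by rewrite !amplitude_out ?mulr0.
  rewrite /amplitude -[k]/(nat_of_ord (Ordinal kn)) !siteE !mxE.
  by apply/eqP; rewrite eq_complex /=; apply/andP; split; apply/eqP; ring.
split=> [g0|k k0|].
- split=> //.
  + by rewrite /= subr0 in he.
  + by rewrite /= subr0 in hg; apply: le_trans hg; exact: ler_norm.
  + by move=> k k0; have := hs k; rewrite (gtn_eqF k0) subr0.
- by have := hd k; rewrite hz (gtn_eqF k0) mulr0 subr0.
- have h := hd 0%N; rewrite hz mulr1 in h.
  have := modulusD (amplitude (slope x) 0 - (2^-1)%:C%C) (2^-1)%:C%C.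
  rewrite subrK modulus_real gtr0_norm ?invr_gt0 //; lra.
Unshelve. all: by end_near. Qed.

Definition family_jacobian x : 'M[R]_(N + N) :=
  jacobian (vector_field (x.1.1, x.1.2, x.2) (beta x)) (state x).

Lemma family_jacobian_base : family_jacobian x0 = uncoupled_mx R n.
Proof. by have [b0 s0] := family_base; rewrite /family_jacobian b0 s0 jacobian_uncoupled. Qed.

Lemma cont_lapf (Q : nat -> R * R * R -> R) k :
  (forall j, cont_at x0 (Q j)) -> cont_at x0 (fun y => lapf n (fun j => Q j y) k).
Proof.
move=> hQ; rewrite /lapf; apply: contD.
  by apply: contD => //; case: k => [|k] //; exact: cont_const.
by apply: contN; apply: contM => //; exact: cont_const.
Qed.

(** The entries are polynomials in the parameters, the driving strength and the state. *)
Lemma cont_jacobian i j : cont_at x0 (fun x => family_jacobian x i j).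
Proof.
pose w : 'rV[R]_(N + N) := delta_mx 0 i.
have hp := cont_p; have hq := cont_q; have hc := @cont_const R _ x0.
have he := cont_eps; have hg := cont_gamma; have ho := cont_omega; have hb := cont_beta.
have entry x : family_jacobian x i j = (w *m family_jacobian x) 0 j by rewrite /w -rowE [RHS]mxE.
have cxE x k : (k <= n)%N -> amplitude (w *m family_jacobian x) k = Complex
    (dfield_p n x.1.1 x.1.2 x.2 (beta x) (fun j => site (p x) j) (fun j => site (q x) j)
      (site (lsubmx w)) (site (rsubmx w)) k)
    (dfield_q n x.1.1 x.1.2 x.2 (beta x) (fun j => site (p x) j) (fun j => site (q x) j)
      (site (lsubmx w)) (site (rsubmx w)) k).
  move=> kn; rewrite amplitude_jacobian // -chain_linE.
  by rewrite (_ : amplitude (state x) = fun j => Complex (site (p x) j) (site (q x) j)) //;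
    apply/funext => l; rewrite amplitude_row_mx.
have hforce k : cont_at x0 (fun x => forcing n (beta x) x.1.2 k).
  by apply: contD; [apply: contM | apply: contN; apply: contM].
move: entry; rewrite -(splitK j); case: (fintype.split j) => l /= entry.
- rewrite (_ : (fun x => _) = fun x => dfield_p n x.1.1 x.1.2 x.2 (beta x)
    (fun j => site (p x) j) (fun j => site (q x) j) (site (lsubmx w)) (site (rsubmx w)) l).
    apply: contD; last by apply: contM.
    apply: contD; first by apply: contD; apply: contM => //; exact: cont_lapf.
    apply: contN; apply: contD; first by do 3![apply: contM => //].
    apply: contM => //; apply: contD; first exact: contM.
    by apply: contM => //; exact: contM.
  apply/funext => x; rewrite entry; have := cxE x l (ltn_ord l).
  by rewrite /amplitude siteE mxE => -[].
- rewrite (_ : (fun x => _) = fun x => dfield_q n x.1.1 x.1.2 x.2 (beta x)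
    (fun j => site (p x) j) (fun j => site (q x) j) (site (lsubmx w)) (site (rsubmx w)) l).
    apply: contD; last by apply: contM.
    apply: contD.
      apply: contD; last by apply: contN; apply: contM.
      by apply: contM; [exact: contN | exact: cont_lapf].
    apply: contD; first by do 3![apply: contM => //].
    apply: contM => //; apply: contD; last exact: contM.
    by apply: contM => //; exact: contM.
  apply/funext => x; rewrite entry; have := cxE x l (ltn_ord l).
  by rewrite /amplitude !siteE !mxE => -[].
Qed.

(** [r] is the radius of the disc around 0 that contains only the two small
    eigenvalues, and [tau] the admissible distance from the base point. *)
Lemma exists_scales (M : nat) (C : R) : (0 < M)%N -> 1 <= C ->
  exists r tau : R,
  [/\ 0 < r, r <= 1, M%:R * (2 * C * (M%:R * r)) <= 4^-1, 0 < tau &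
  [/\ tau <= 4^-1, 16 ^+ n * tau <= 200^-1, 56 * tau < r ^+ 2,
    120 * tau <= r & 10 * tau * C <= 4^-1]].
Proof.
move=> M0 C1; pose r : R := (8 * (M%:R * M%:R) * C)^-1.
have M1 : 1 <= M%:R :> R by rewrite ler1n.
have MM1 : 1 <= M%:R * M%:R :> R by rewrite -[leLHS]mulr1; apply: ler_pM.
have MMC : 1 <= M%:R * M%:R * C by rewrite -[leLHS]mulr1; apply: ler_pM.
have r0 : 0 < r by rewrite invr_gt0; lra.
have r1 : r <= 1 by rewrite invf_le1; lra.
have rC : M%:R * (2 * C * (M%:R * r)) <= 4^-1.
  rewrite (_ : _ * _ = 4^-1) //.
  rewrite /r; field; apply/andP; split; apply: lt0r_neq0; lra.
have : 1 <= 16 ^+ n :> R by apply: exprn_ege1; lra.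
have r2 : 0 < r ^+ 2 by rewrite exprn_gt0.
have r2r : r ^+ 2 <= r by rewrite expr2 ler_piMl // ltW.
move: (16 ^+ n : R) (r) r0 r1 rC r2 r2r => e16 r' r0 r1 rC r2 r2r e16_ge1.
clear - C1 e16_ge1 r0 r1 rC r2 r2r.
exists r', (r' ^+ 2 / (200 * (e16 * C))).
have den : 1 <= e16 * C by rewrite -[leLHS]mulr1; apply: ler_pM.
have dgt : 0 < 200 * (e16 * C) by lra.
set tau := _ / _.
have tauE : tau * (200 * (e16 * C)) = r' ^+ 2 by rewrite divfK // lt0r_neq0.
have tau0 : 0 < tau by rewrite divr_gt0.
have t1 : tau <= tau * (e16 * C) by rewrite ler_peMr // ltW.
have t2 : tau * e16 <= tau * (e16 * C).
  by rewrite ler_wpM2l ?(ltW tau0) // ler_peMr //; lra.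
have t3 : tau * C <= tau * (e16 * C).
  by rewrite ler_wpM2l ?(ltW tau0) // ler_peMl //; lra.
clearbody tau; split=> //; split; lra.
Qed.

Lemma near_le_l (y z t C : R) : `|y - z| < 4^-1 -> 0 <= t -> 1 + `|z| + t <= C -> `|y| <= C.
Proof. by move=> h; have := ler_normD (y - z) z; rewrite subrK; lra. Qed.

Lemma near_le_r (y z t C : R) : `|y - z| < 4^-1 -> 0 <= t -> 1 + t + `|z| <= C -> `|y| <= C.
Proof. by move=> h; have := ler_normD (y - z) z; rewrite subrK; lra. Qed.

Lemma near1_ge (y z : R) : `|y - z| < 4^-1 -> z = 1 -> 3 / 4 <= y.
Proof. by rewrite ltr_norml => /andP[]; lra. Qed.

Lemma near2_bounds (y z : R) : `|y - z| < 4^-1 -> z = 2 -> 1 <= y <= 3.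
Proof.
by rewrite ltr_norml => /andP[h1 h2] zE; apply/andP; split; lra.
Qed.

Definition split_spectrum x (lambda : R) : Prop := exists s : seq R[i],
  [/\ 0 < lambda, lambda <= 120 * x.1.2, size s = (n + n)%N,
      forall z, z \in s -> complex.Re z < 0 &
      char_poly (map_mx (real_complex R) (family_jacobian x)) =
        \prod_(z <- [:: 0, real_complex R lambda & s]) ('X - z%:P)].

Lemma family_spectrum : \forall x \near x0, x.1.1 != 0 -> 0 < x.1.2 ->
  exists lambda, split_spectrum x lambda.
Proof.
have [b0 s0] := family_base.
pose a x : R := complex.Re (amplitude (state x) 0%N).
have a0 : a x0 = 1 by rewrite /a s0 amplitude_head_p /=.
pose Dh x := adj_coord (family_jacobian x) (slope x) (head_q_index n).
pose De x := adj_coord (family_jacobian x) (a x *: head_p R n) (head_q_index n).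
have De0 : (De x0)`_0 = 2.
  by rewrite /De a0 scale1r family_jacobian_base adj_coord_uncoupled0.
have Dh0 : (Dh x0)`_0 = 1.
  rewrite /Dh slope_base family_jacobian_base adj_coordZ coefCM adj_coord_uncoupled0.
  by rewrite mulVf // pnatr_eq0.
have cDh : coefs_cont x0 Dh.
  apply: coefs_adj_coord; first exact: cont_jacobian.
  move=> j; rewrite -(splitK j); case: (fintype.split j) => l /=.
    rewrite (_ : (fun x => _) = fun x => site ('D_domega p x) l); first exact: cont_dp.
    by apply/funext => x; rewrite row_mxEl siteE.
  rewrite (_ : (fun x => _) = fun x => site ('D_domega q x) l); first exact: cont_dq.
  by apply/funext => x; rewrite row_mxEr siteE.
have cDe : coefs_cont x0 De.
  apply: coefs_adj_coord; first exact: cont_jacobian.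
  move=> j; rewrite (_ : (fun x => _) = fun x => site (p x) 0 * head_p R n 0 j).
    by apply: contM; [exact: cont_p | exact: cont_const].
  by apply/funext => x; rewrite mxE /a amplitude_row_mx.
set M := (n + n).+2.
pose C := 1 + \sum_(k < M) (`|(Dh x0)`_k| + `|(De x0)`_k|).
have C1 : 1 <= C by rewrite lerDl sumr_ge0 // => i _; rewrite addr_ge0.
have C_ge (k : 'I_M) : 1 + `|(Dh x0)`_k| + `|(De x0)`_k| <= C.
  rewrite -addrA lerD2l (bigD1 k) //= lerDl.
  by apply: sumr_ge0 => i _; rewrite addr_ge0.
have [r [tau [r0 r1 rC tau0 [tau4 tau16 taur taur2 tauC]]]] :=
  exists_scales (ltn0Sn _ : (0 < M)%N) C1.
near=> x => eps0 g0.
have Ux : U x by near: x; exact: near_U.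
have [nss wt w0] : [/\ 0 < x.1.2 -> near_single_site tau x.1.1 x.1.2 x.2 (amplitude (state x)),
      forall k, (0 < k)%N -> modulus (amplitude (slope x) k) <= tau &
      modulus (amplitude (slope x) 0) <= 1].
  by near: x; exact: near_family.
have hDh : forall i : 'I_M, `|(Dh x)`_i - (Dh x0)`_i| < 4^-1.
  by near: x; apply: near_small => [i|]; [exact: cDh | rewrite invr_gt0].
have hDe : forall i : 'I_M, `|(De x)`_i - (De x0)`_i| < 4^-1.
  by near: x; apply: near_small => [i|]; [exact: cDe | rewrite invr_gt0].
have C_geh (k : 'I_M) : `|(Dh x)`_k| <= C.
  exact: (near_le_l (hDh k) (normr_ge0 _) (C_ge k)).
have C_gee (k : 'I_M) : `|(De x)`_k| <= C.
  exact: (near_le_r (hDe k) (normr_ge0 _) (C_ge k)).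
have Dh1 : 3 / 4 <= (Dh x)`_0 by apply: near1_ge (hDh ord0) Dh0.
have De1 : 1 <= (De x)`_0 <= 3 by apply: near2_bounds (hDe ord0) De0.
apply: (@spectrum R n n_gt0 tau r C x.1.1 x.1.2 x.2 (beta x) ('D_domega beta x) (state x) (slope x))
  => //.
- exact: le_trans C1.
- exact: nss.
- exact: state_stationary.
- by move=> k kn; exact: slope_equation.
- exact: balance_slope.
- by rewrite amplitude_row_mx; exact: site_q0.
- by rewrite amplitude_row_mx; exact: slope_q0.
- by move=> k kM; exact: (C_geh (Ordinal kM)).
- by move=> k kM; exact: (C_gee (Ordinal kM)).
Unshelve. all: by end_near. Qed.

End Family.

Theorem mainTheorem3 (R : realType) (N : nat) (hN : (2 <= N)%N)
    (beta : R * R * R -> R) (p q : R * R * R -> 'rV[R]_N)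
    (hbreather : breather_family beta p q) :
  exists (delta : R) (lambda : R * R * R -> R),
    [/\ 0 < delta,
        forall eps gamma omega : R,
          eps != 0 -> `|eps| < delta ->
          0 < gamma -> gamma < delta ->
          `|omega - 1| < delta ->
          let x := (eps, gamma, omega) in
          let A := linearization x (beta x) (p x) (q x) in
          let g := rotation_generator (p x) (q x) in
          [/\ 0 < lambda x,
              exists s : seq R[i],
                [/\ size s = (2 * N - 2)%N,
                    forall z : R[i], z \in s -> complex.Re z < 0 &
                    eigenvalues A [:: 0, real_complex R (lambda x) & s]] &
              g != 0 /\ A *m g^T = 0] &
        forall eta : R, 0 < eta ->
          exists delta' : R, 0 < delta' /\
            forall eps gamma omega : R,
              eps != 0 -> `|eps| < delta -> `|eps| < delta' ->
              0 < gamma -> gamma < delta -> gamma < delta' ->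
              `|omega - 1| < delta ->
              lambda (eps, gamma, omega) < eta].
Proof.
case: N hN p q hbreather => [|[|n]] // _ p q [U [rho [openU Ux0 rho0 br [smp smq]]]].
have n0 : (0 < n.+1)%N by [].
have near := family_spectrum n0 openU Ux0 rho0 br smp smq.
have /nbhs_ballP[delta /= delta0 ball_good] :
    \forall x \near ((0, 0, 1) : R * R * R)%classic, U x /\
      (x.1.1 != 0 -> 0 < x.1.2 -> exists lambda, split_spectrum beta p q x lambda).
  by apply: filterS2 near (near_U openU Ux0) => x h Ux.
(* lambda is selected pointwise among the values provided by family_spectrum *)
have pick x : exists l, (exists l', split_spectrum beta p q x l') ->
    split_spectrum beta p q x l.
  have [[l hl]|no] := pselect (exists l, split_spectrum beta p q x l); first by exists l.
  by exists 0 => /no.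
have [lambda hl] := choice pick.
have good eps gamma omega : eps != 0 -> `|eps| < delta -> 0 < gamma -> gamma < delta ->
    `|omega - 1| < delta -> U (eps, gamma, omega) /\
    split_spectrum beta p q (eps, gamma, omega) (lambda (eps, gamma, omega)).
  move=> e0 e1 g0 g1 o1.
  have hball : ball ((0, 0, 1) : R * R * R) delta (eps, gamma, omega).
    split; [split|]; rewrite /ball /= ?sub0r ?normrN //; first by rewrite gtr0_norm.
    by rewrite distrC.
  have [Ux h] := ball_good _ hball.
  by split=> //; apply: hl; exact: h.
exists delta, lambda; split=> //.
- move=> eps gamma omega e0 e1 g0 g1 o1 /=.
  have [Ux [s [l0 _ ss sneg chi]]] := good _ _ _ e0 e1 g0 g1 o1.
  have AE : linearization (eps, gamma, omega) (beta (eps, gamma, omega))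
      (p (eps, gamma, omega)) (q (eps, gamma, omega))
      = (family_jacobian beta p q (eps, gamma, omega))^T by [].
  split=> //.
    exists s; split=> //; first by rewrite ss; clear; lia.
    by rewrite /eigenvalues AE -map_trmx char_poly_trmx.
  have [st _ [_ p0] _] := br _ Ux; split.
    apply: contraTneq p0 => g0'; rewrite -leNgt.
    have : rotation_generator (p (eps, gamma, omega)) (q (eps, gamma, omega)) 0
       (rshift _ ord0) = 0 by rewrite g0' mxE.
    by rewrite /rotation_generator row_mxEr -siteE => ->.
  rewrite AE -trmx_mul; apply/(canLR trmxK); rewrite trmx0.
  exact: rotation_generator_ker.
- move=> eta eta0; exists (eta / 120); split; first by rewrite divr_gt0.
  move=> eps gamma omega e0 e1 _ g0 g1 g2 o1.
  have [_ [s [_ ll _ _ _]]] := good _ _ _ e0 e1 g0 g1 o1.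
  by apply: le_lt_trans ll _; rewrite mulrC -ltr_pdivlMr.
Qed.
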